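(* The forgetful functor $U:\mathbf{Prop}\to\mathbf{Operad}$ has a left adjoint $F:\mathbf{Operad}\to\mathbf{Prop}$ with $\mathrm{col}(F(\mathcal O))=\mathrm{col}(\mathcal O)$ for every operad $\mathcal O$. An element of $F(\mathcal O)(\langle a_1,\dots,a_n\rangle;\langle b_1,\dots,b_m\rangle)$ is given by a pair $(\theta,\langle f_j\rangle_{j=1}^m)$, where $\theta:\{1,\dots,n\}\to\{1,\dots,m\}$ is a function and, for each $j$, $f_j:\langle a_i\rangle_{\theta(i)=j}\to b_j$ is an operation of $\mathcal O$ (the inputs $a_i$ with $\theta(i)=j$ being listed in increasing order of $i$).
   Context: $\mathbf{Operad}$ is the category of colored symmetric operads (symmetric multicategories) in sets, with a set of colors $\mathrm{col}(\mathcal O)$ and operation sets $\mathcal O(\langle c_1,\dots,c_n\rangle;c)$, $n\ge0$; morphisms may change colors. A list is a finite, possibly empty, sequence $\langle a_i\rangle_{i=1}^n=\langle a_1,\dots,a_n\rangle$; brackets are omitted when $n=1$. A prop $\mathcal T$ consists of: a set of colors $\mathrm{col}(\mathcal T)$; for all lists of colors a set of operations (morphisms) $\mathcal T(\langle a_i\rangle_{i=1}^n;\langle b_k\rangle_{k=1}^m)$, $n,m\ge 0$, whose elements are written $f:\langle a_i\rangle_{i=1}^n\to\langle b_k\rangle_{k=1}^m$; an element $\mathrm{id}_c\in\mathcal T(c;c)$ for each color $c$; an associative vertical composition $\mathcal T(\langle a_i\rangle;\langle b_k\rangle)\times\mathcal T(\langle c_j\rangle;\langle a_i\rangle)\to\mathcal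 T(\langle c_j\rangle;\langle b_k\rangle)$, $(f,g)\mapsto f\circ_v g$; an associative horizontal composition $\mathcal T(\langle a_i\rangle_{i=1}^n;\langle b_k\rangle_{k=1}^m)\times\mathcal T(\langle a_i\rangle_{i=n+1}^{n+p};\langle b_k\rangle_{k=m+1}^{m+q})\to\mathcal T(\langle a_i\rangle_{i=1}^{n+p};\langle b_k\rangle_{k=1}^{m+q})$, $(f,g)\mapsto f\circ_h g$; and maps $\sigma^*:\mathcal T(\langle a_i\rangle_{i=1}^n;\langle b_k\rangle_{k=1}^m)\to\mathcal T(\langle a_{\sigma(i)}\rangle_{i=1}^n;\langle b_k\rangle_{k=1}^m)$ for $\sigma\in\Sigma_n$ and $\tau_*:\mathcal T(\langle a_i\rangle_{i=1}^n;\langle b_k\rangle_{k=1}^m)\to\mathcal T(\langle a_i\rangle_{i=1}^n;\langle b_{\tau^{-1}(k)}\rangle_{k=1}^m)$ for $\tau\in\Sigma_m$. The empty horizontal composite is a specified element $\mathrm{id}_{\langle\rangle}\in\mathcal T(\langle\rangle;\langle\rangle)$ which is a two-sided unit for $\circ_h$. Axioms: (i) $f\circ_v(\mathrm{id}_{a_1}\circ_h\cdots\circ_h\mathrm{id}_{a_n})=f=(\mathrm{id}_{b_1}\circ_h\cdots\circ_h\mathrm{id}_{b_m})\circ_v f$; (ii) $(f\circ_v g)\circ_h(f'\circ_v g')=(f\circ_h f')\circ_v(g\circ_h g')$ whenever the vertical compositions on the left are defined; (iii) $f\circ_v(\sigma_*g)=(\sigma^*f)\circ_v g$, $\sigma^*(f\circ_v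 g)=f\circ_v(\sigma^*g)$, $\tau_*(f\circ_v g)=(\tau_*f)\circ_v g$; (iv) $(\sigma^*f)\circ_h(\bar\sigma^*g)=(\sigma\times\bar\sigma)^*(f\circ_h g)$ and $(\tau_*f)\circ_h(\bar\tau_*g)=(\tau\times\bar\tau)_*(f\circ_h g)$; (v) if $f$ has $n$ inputs and $m$ outputs and $g$ has $p$ inputs and $q$ outputs, then $(\sigma_{n,p})^*(\sigma_{q,m})_*(f\circ_h g)=g\circ_h f$, where $\sigma_{x,y}\in\Sigma_{x+y}$ restricts to increasing bijections $[1,y]\to[x+1,x+y]$ and $[y+1,x+y]\to[1,x]$; (vi) $\sigma^*\tau_*=\tau_*\sigma^*$, $\sigma^*\bar\sigma^*=(\bar\sigma\sigma)^*$, $\tau_*\bar\tau_*=(\tau\bar\tau)_*$, and identity permutations act trivially. A prop homomorphism $f:\mathcal R\to\mathcal T$ is a map $\mathrm{col}(\mathcal R)\to\mathrm{col}(\mathcal T)$ together with maps $\mathcal R(\langle a_i\rangle;\langle b_j\rangle)\to\mathcal T(\langle fa_i\rangle;\langle fb_j\rangle)$ commuting with all compositions, identities (including $\mathrm{id}_{\langle\rangle}$) and symmetric group actions. $\mathbf{Prop}$ is the resulting category. The forgetful functor $U$ sends $\mathcal T$ to the operad $U(\mathcal T)$ with the same colors, operations $U(\mathcal T)(\langle a_1,\dots,a_n\rangle;b)=\mathcal T(\langle a_1,\dots,a_n\rangle;b)$, the evident identities and symmetric actions, and operadic composition $\gamma(g,\langle f_i\rangle_{i=1}^n)=g\circ_v(f_1\circ_h\cdots\circ_h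 f_n)$. *)

(* Defs.v *)
From Stdlib Require Import Permutation.
From mathcomp Require Import all_boot all_order all_fingroup.
From mathcomp Require Import boolp.
From mathcomp Require Import zify.

Set Implicit Arguments.
Unset Strict Implicit.
Unset Printing Implicit Defensive.

Record category := Category {
  obj :> Type;
  hom : obj -> obj -> Type;
  idm : forall X, hom X X;
  comp : forall X Y Z, hom Y Z -> hom X Y -> hom X Z;
  compA : forall X Y Z W (h : hom Z W) (g : hom Y Z) (f : hom X Y),
    comp h (comp g f) = comp (comp h g) f;
  comp1m : forall X Y (f : hom X Y), comp (idm Y) f = f;
  compm1 : forall X Y (f : hom X Y), comp f (idm X) = f }.
Arguments idm {c} X.
Arguments comp {c X Y Z} g f : rename.

(* The object map is a parameter, so that one can assert that a functor with a
   given object map exists without transporting along equalities of objects. *)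
Record functor_on (C D : category) (F0 : C -> D) := FunctorOn {
  fmap_on : forall X Y : C, hom X Y -> hom (F0 X) (F0 Y);
  fmap_on_id : forall X, fmap_on (idm X) = idm (F0 X);
  fmap_on_comp : forall X Y Z (g : hom Y Z) (f : hom X Y),
    fmap_on (comp g f) = comp (fmap_on g) (fmap_on f) }.

Record functor (C D : category) := Functor {
  fobj :> C -> D;
  fstr : functor_on fobj }.
Definition fmap C D (F : functor C D) X Y : hom X Y -> hom (F X) (F Y) :=
  fmap_on (fstr F) (Y := Y).

Record adjunction (C D : category) (F : functor C D) (G : functor D C) :=
  Adjunction {
    adj : forall X Y, hom (F X) Y -> hom X (G Y);
    adj_bij : forall X Y, bijective (@adj X Y);
    adj_naturall : forall X X' Y (u : hom X' X) (v : hom (F X) Y),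
      adj (comp v (fmap F u)) = comp (adj v) u;
    adj_naturalr : forall X Y Y' (w : hom Y Y') (v : hom (F X) Y),
      adj (comp w v) = comp (fmap G w) (adj v) }.

Definition adj_unit C D (F : functor C D) (G : functor D C)
  (A : adjunction F G) X : hom X (G (F X)) := adj A (idm (F X)).

(* [lcat aa] is aa_0 ++ ... ++ aa_(n-1). A fixpoint rather than a big operator,
   so that it computes on the indices of the operation sets below. *)
Fixpoint lcat C n : ('I_n -> seq C) -> seq C :=
  match n with
  | 0 => fun _ => [::]
  | n'.+1 => fun aa => aa ord0 ++ lcat (fun i => aa (lift ord0 i))
  end.

Definition lst C n (a : 'I_n -> C) : seq C := lcat (fun i => [:: a i]).

(* <a_(s 0), ..., a_(s (n-1))>. Note that (s * t)%g i = t (s i) for perms. *)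
Definition permt C n (a : n.-tuple C) (s : 'S_n) : n.-tuple C :=
  [tuple tnth a (s i) | i < n].

Lemma lcatE C n (aa : 'I_n -> seq C) :
  lcat aa = flatten [seq aa i | i <- enum 'I_n].
Proof.
elim: n aa => [|n IH] aa; first by rewrite enum_ord0.
by rewrite enum_ordSl /= IH -map_comp.
Qed.

Lemma lstE C n (a : 'I_n -> C) : lst a = [seq a i | i <- enum 'I_n].
Proof. by rewrite /lst lcatE (map_comp (fun c => [:: c])) flatten_seq1. Qed.

Lemma lst_tnth C n (a : n.-tuple C) : lst (tnth a) = a.
Proof. by rewrite lstE map_tnth_enum. Qed.

Lemma map_lcat C D (h : C -> D) n (aa : 'I_n -> seq C) :
  map h (lcat aa) = lcat (fun i => map h (aa i)).
Proof. by elim: n aa => //= n IH aa; rewrite map_cat IH. Qed.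

Lemma size_lcat C n (k : 'I_n -> nat) (a : forall i, (k i).-tuple C) :
  size (lcat a) == \sum_i k i.
Proof.
apply/eqP; elim: n k a => [|n IH] k a; first by rewrite big_ord0.
by rewrite big_ord_recl /= size_cat size_tuple (IH _ (fun i => a (lift ord0 i))).
Qed.
Canonical lcat_tuple C n (k : 'I_n -> nat) (a : forall i, (k i).-tuple C) :=
  Tuple (size_lcat a).

Lemma flatten_iota n (k : 'I_n -> nat) m :
  flatten [seq iota (m + \sum_(l < n | l < i) k l) (k i) | i : 'I_n <- enum 'I_n] =
  iota m (\sum_i k i).
Proof.
elim: n k m => [|n IH] k m; first by rewrite enum_ord0 big_ord0.
rewrite enum_ordSl big_ord_recl iotaD /= big_pred0 // addn0 -IH -map_comp.
congr (_ ++ flatten _); apply: eq_map => i /=.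
rewrite big_mkcond big_ord_recl /= -addnA; congr (iota (_ + (_ + _)) _).
by rewrite [RHS]big_mkcond; apply: eq_bigr => l _; rewrite /= ltnS.
Qed.

(* An index q < \sum_i k i is handled through [tagnat] as the pair
   (sig1 q, sig2 q), in lexicographic order. *)
Lemma lcat_sig C n (k : 'I_n -> nat) (x : forall i, 'I_(k i) -> seq C) :
  lcat (fun i => lcat (x i)) =
  lcat (fun q : 'I_(\sum_i k i) => x (tagnat.sig1 q) (tagnat.sig2 q)).
Proof.
pose u (p : {i & 'I_(k i)}) := x (tag p) (tagged p).
have -> : lcat (fun q => x (tagnat.sig1 q) (tagnat.sig2 q)) =
    flatten [seq u (tagnat.sig q) | q <- enum 'I_(\sum_i k i)].
  by rewrite lcatE.
have -> : enum 'I_(\sum_i k i) =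
    flatten [seq [seq @tagnat.Rank n k i j | j <- enum 'I_(k i)] | i <- enum 'I_n].
  apply: (inj_map val_inj); rewrite val_enum_ord -(flatten_iota k 0).
  rewrite map_flatten -[in RHS]map_comp; congr flatten; apply: eq_map => i /=.
  rewrite add0n -map_comp -[X in iota X]addn0 iotaDl -val_enum_ord -map_comp.
  by apply: eq_map => j /=; exact/esym/tagnat.RankEsum.
rewrite lcatE; elim: (enum 'I_n) => //= i e ->.
rewrite map_cat flatten_cat lcatE -map_comp; congr (flatten _ ++ _).
by apply: eq_map => j; rewrite /u /tagnat.Rank /= tagnat.rankK.
Qed.

Lemma lst_sig C n (k : 'I_n -> nat) (a : forall i, 'I_(k i) -> C) :
  lcat (fun i => lst (a i)) =
  lst (fun q : 'I_(\sum_i k i) => a (tagnat.sig1 q) (tagnat.sig2 q)).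
Proof. exact: (lcat_sig (fun i j => [:: a i j])). Qed.

Lemma tnth_lcat C n (k : 'I_n -> nat) (a : forall i, (k i).-tuple C) i j :
  tnth (lcat_tuple a) (@tagnat.Rank n k i j) = tnth (a i) j.
Proof.
have -> : lcat_tuple a =
    [tuple tnth (a (tagnat.sig1 q)) (tagnat.sig2 q) | q < \sum_i k i].
  apply: val_inj => /=; rewrite -lstE -(lst_sig (fun i => tnth (a i))) !lcatE.
  by congr flatten; apply: eq_map => l; rewrite lst_tnth.
rewrite tnth_mktuple.
pose u (p : {i & 'I_(k i)}) := tnth (a (tag p)) (tagged p).
by rewrite -/(u (tagnat.sig _)) /tagnat.Rank tagnat.rankK.
Qed.

Lemma permt_id C n (a : n.-tuple C) : permt a 1%g = a :> seq C.
Proof.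
by congr val; apply: eq_from_tnth => i; rewrite tnth_mktuple perm1.
Qed.

Lemma permt_mul C n (a : n.-tuple C) (s t : 'S_n) :
  permt (permt a t) s = permt a (s * t)%g :> seq C.
Proof.
by congr val; apply: eq_from_tnth => i; rewrite !tnth_mktuple permM.
Qed.

Lemma permtK C n (a : n.-tuple C) (s : 'S_n) :
  permt (permt a s) s^-1%g = a :> seq C.
Proof. by rewrite permt_mul mulVg permt_id. Qed.

Lemma permt_idV C n (a : n.-tuple C) : a = permt a 1^-1%g :> seq C.
Proof. by rewrite invg1 permt_id. Qed.

Lemma permt_mulV C n (a : n.-tuple C) (s t : 'S_n) :
  permt a (t * s)^-1%g = permt (permt a t^-1%g) s^-1%g :> seq C.
Proof. by rewrite permt_mul invMg. Qed.

Lemma permt_map C D (h : C -> D) n (a : n.-tuple C) (s : 'S_n) :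
  permt (map_tuple h a) s = map h (permt a s) :> seq D.
Proof.
rewrite -[RHS]/(val (map_tuple h (permt a s))).
by congr val; apply: eq_from_tnth => i; rewrite !(tnth_map, tnth_mktuple).
Qed.

Lemma map_lst C D (h : C -> D) n (a : 'I_n -> C) :
  map h (lst a) = lst (h \o a).
Proof. exact: map_lcat. Qed.

Lemma size_lst C n (a : 'I_n -> C) : size (lst a) == n.
Proof. by rewrite lstE size_map size_enum_ord. Qed.
Canonical lst_tuple C n (a : 'I_n -> C) := Tuple (size_lst a).

Lemma permt_lst C n (a : 'I_n -> C) (s : 'S_n) :
  permt (lst_tuple a) s = lst (a \o s) :> seq C.
Proof.
have -> : lst_tuple a = [tuple a i | i < n] by apply: val_inj; rewrite /= lstE.
by rewrite /= lstE; apply: eq_map => i; rewrite tnth_mktuple.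
Qed.

(* The permutation s x t of 'I_(n + p). *)
Definition psum_fun n p (s : 'S_n) (t : 'S_p) (i : 'I_(n + p)) : 'I_(n + p) :=
  match split i with inl j => lshift p (s j) | inr j => rshift n (t j) end.
Lemma psum_inj n p s t : injective (@psum_fun n p s t).
Proof.
apply: (can_inj (g := psum_fun s^-1%g t^-1%g)) => i; rewrite /psum_fun.
case: (split_ordP i) => j ->; case: split_ordP => l /eqP;
  rewrite ?(eq_lshift, eq_rshift, eq_lrshift, eq_rlshift) // => /eqP <-;
  by rewrite permK.
Qed.
Definition psum n p (s : 'S_n) (t : 'S_p) : 'S_(n + p) := perm (@psum_inj n p s t).

Lemma psumV n p (s : 'S_n) (t : 'S_p) : (psum s t)^-1%g = psum s^-1%g t^-1%g.
Proof.
apply: (@mulgI _ (psum s t)); rewrite mulgV; apply/permP => i.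
rewrite permM !permE /= /psum_fun.
case: (split_ordP i) => j ->; case: split_ordP => l /eqP;
  rewrite ?(eq_lshift, eq_rshift, eq_lrshift, eq_rlshift) // => /eqP <-;
  by rewrite permK.
Qed.

Lemma permt_cat C n p (a : n.-tuple C) (a' : p.-tuple C) (s : 'S_n) (t : 'S_p) :
  permt a s ++ permt a' t = permt (cat_tuple a a') (psum s t) :> seq C.
Proof.
rewrite -[LHS]/(val (cat_tuple _ _)); congr val; apply: eq_from_tnth => i.
rewrite tnth_mktuple permE /psum_fun.
by case: (split_ordP i) => j ->; rewrite ?(tnth_lshift, tnth_rshift) tnth_mktuple.
Qed.

Lemma permt_catV C n p (a : n.-tuple C) (a' : p.-tuple C) (s : 'S_n) (t : 'S_p) :
  permt a s^-1%g ++ permt a' t^-1%g = permt (cat_tuple a a') (psum s t)^-1 :> seq C.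
Proof. by rewrite permt_cat psumV. Qed.

(* sigma_{x,y}: i |-> x + i for i < y, and i |-> i - y for y <= i < x + y. *)
Definition bswap_nat x y i := if i < y then x + i else i - y.
Lemma bswap_subproof x y (i : 'I_(x + y)) : bswap_nat x y i < x + y.
Proof. by have := ltn_ord i; rewrite /bswap_nat; case: ifP; lia. Qed.
Lemma bswap_inj x y : injective (fun i => Ordinal (@bswap_subproof x y i)).
Proof.
move=> i j [H]; apply: val_inj => /=; move: H (ltn_ord i) (ltn_ord j).
by rewrite /bswap_nat; do 2![case: ifP]; lia.
Qed.
Definition bswap x y : 'S_(x + y) := perm (@bswap_inj x y).

Lemma permt_bswap C n p (a : n.-tuple C) (a' : p.-tuple C) :
  permt (cat_tuple a a') (bswap n p) = cat_tuple a' a :> seq C.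
Proof.
have [c|C0] := pselect (exists c : C, True).
  case: c => c _; apply: (@eq_from_nth _ c) => [|i].
    by rewrite !size_tuple addnC.
  rewrite size_tuple => li; rewrite -[i]/(val (Ordinal li)) -tnth_nth.
  rewrite tnth_mktuple permE (tnth_nth c) /= /bswap_nat !nth_cat !size_tuple.
  case: (ltnP i p) => ip; last by rewrite ifT //; lia.
  by rewrite ifF ?addKn //; lia.
have h k (t : k.-tuple C) : t = [::] :> seq C.
  by case: t => -[|c t] //= _; case: C0; exists c.
by rewrite !h.
Qed.

(* [bswap q m] is a permutation of 'I_(q + m), but acts on a list of length
   m + q. *)
Lemma permt_bswapV C m q (b : m.-tuple C) (b' : q.-tuple C) :
  permt (cat_tuple b b') (cast_perm (addnC q m) (bswap q m))^-1%g =
  cat_tuple b' b :> seq C.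
Proof.
rewrite -(permt_bswap b b'); congr (val (permt _ _)).
apply: (@mulgI _ (cast_perm (addnC q m) (bswap q m))); rewrite mulgV.
apply/permP => i; rewrite permM perm1 cast_permE !permE.
apply: val_inj => /=; have := ltn_ord i.
by rewrite /= /bswap_nat; do 2!case: ifP; lia.
Qed.

(* The permutation s_0 x ... x s_(n-1). *)
Definition pdiag_fun n (k : 'I_n -> nat) (s : forall i, 'S_(k i))
    (q : 'I_(\sum_i k i)) : 'I_(\sum_i k i) :=
  tagnat.Rank _ (s (tagnat.sig1 q) (tagnat.sig2 q)).
Lemma pdiag_inj n k s : injective (@pdiag_fun n k s).
Proof.
pose u (p : {i & 'I_(k i)}) := Tagged (fun i => 'I_(k i)) (s (tag p) (tagged p)).
have u_inj : injective u.
  case=> i j [i' j'] /= eq_u; have /= ii' := congr1 tag eq_u.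
  by case: _ / ii' j' eq_u => j' /eqP; rewrite eq_Tagged => /eqP/= /perm_inj ->.
by move=> q q' /tagnat.rank_inj/u_inj/tagnat.sig_inj.
Qed.
Definition pdiag n (k : 'I_n -> nat) (s : forall i, 'S_(k i)) :
  'S_(\sum_i k i) := perm (@pdiag_inj n k s).

Lemma permt_pdiag C n (k : 'I_n -> nat) (a : forall i, (k i).-tuple C)
    (s : forall i, 'S_(k i)) :
  lcat (fun i => permt (a i) (s i)) = permt (lcat_tuple a) (pdiag s).
Proof.
rewrite -[LHS]/(val (lcat_tuple (fun i => permt (a i) (s i)))).
congr val; apply: eq_from_tnth => q; rewrite -{1}[q]tagnat.sig2K tnth_lcat.
by rewrite !tnth_mktuple permE tnth_lcat.
Qed.

(* The block permutation of s: the j-th element of the i-th block of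
   \sum_i k (s i) is sent to the j-th element of the (s i)-th block of
   \sum_i k i. *)
Lemma pblock_subproof n (k : 'I_n -> nat) (s : 'S_n) :
  \sum_i k i = \sum_i k (s i).
Proof. exact: reindex_inj perm_inj. Qed.
Definition pblock_fun n (k : 'I_n -> nat) (s : 'S_n)
    (q : 'I_(\sum_i k i)) : 'I_(\sum_i k i) :=
  let q' := cast_ord (pblock_subproof k s) q in
  @tagnat.Rank n k (s (tagnat.sig1 q')) (tagnat.sig2 q').
Lemma pblock_inj n k s : injective (@pblock_fun n k s).
Proof.
pose u (p : {i & 'I_(k (s i))}) := Tagged (fun i => 'I_(k i)) (tagged p).
have u_inj : injective u.
  case=> i j [i' j'] /= eq_u; have /= /perm_inj ii' := congr1 tag eq_u.
  by case: _ / ii' j' eq_u => j' /eqP; rewrite eq_Tagged => /eqP/= ->.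
by move=> q q' /tagnat.rank_inj/u_inj/tagnat.sig_inj/cast_ord_inj.
Qed.
Definition pblock n (k : 'I_n -> nat) (s : 'S_n) : 'S_(\sum_i k i) :=
  perm (@pblock_inj n k s).

Lemma permt_pblock C n (k : 'I_n -> nat) (a : forall i, (k i).-tuple C)
    (s : 'S_n) :
  lcat (fun i => a (s i)) = permt (lcat_tuple a) (pblock k s).
Proof.
set a' := fun i => a (s i); rewrite -[LHS]/(val (lcat_tuple a')).
set e := pblock_subproof k s.
have -> : val (lcat_tuple a') = val (tcast (esym e) (lcat_tuple a')).
  exact/esym/val_tcast.
congr val; apply: eq_from_tnth => q; rewrite tcastE esymK tnth_mktuple permE.
by rewrite tnth_lcat -[cast_ord _ _ in LHS]tagnat.sig2K tnth_lcat.
Qed.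

Definition mcast C (T : seq C -> seq C -> Type) a a' b b'
    (ea : a = a') (eb : b = b') (f : T a b) : T a' b' :=
  ecast x (T x b') ea (ecast y (T a y) eb f).

Definition ocast C (O : seq C -> C -> Type) a a' c (e : a = a') (f : O a c) :
  O a' c := ecast x (O x c) e f.

(* [mlact f s] is s^* f and [mract f s] is s_* f. *)
Record prop_data (C : Type) := PropData {
  mor :> seq C -> seq C -> Type;
  mid : forall c, mor [:: c] [:: c];
  mid0 : mor [::] [::];
  mvcomp : forall a b c, mor b c -> mor a b -> mor a c;
  mhcomp : forall a b a' b', mor a b -> mor a' b' -> mor (a ++ a') (b ++ b');
  mlact : forall n (a : n.-tuple C) b, mor a b -> forall s : 'S_n,
    mor (permt a s) b;
  mract : forall m a (b : m.-tuple C), mor a b -> forall s : 'S_m,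
    mor a (permt b s^-1%g) }.
Arguments mid {C} p c : rename.
Arguments mid0 {C} p : rename.
Arguments mvcomp {C p a b c} f g : rename.
Arguments mhcomp {C p a b a' b'} f g : rename.
Arguments mlact {C p n a b} f s : rename.
Arguments mract {C p m a b} f s : rename.

(* id_(a_1) o_h ... o_h id_(a_n) *)
Fixpoint midl C (T : prop_data C) (a : seq C) : T a a :=
  match a with
  | [::] => mid0 T
  | c :: a' => mhcomp (mid T c) (midl T a')
  end.

(* f_0 o_h ... o_h f_(n-1) *)
Fixpoint mhcat C (T : prop_data C) n :
    forall (a b : 'I_n -> seq C), (forall i, T (a i) (b i)) ->
    T (lcat a) (lcat b) :=
  match n with
  | 0 => fun _ _ _ => mid0 T
  | n'.+1 => fun _ _ f => mhcomp (f ord0) (mhcat (fun i => f (lift ord0 i)))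
  end.

Record prop_axioms C (T : prop_data C) : Prop := PropAxioms {
  mvcompA : forall a b c d (f : T c d) (g : T b c) (h : T a b),
    mvcomp f (mvcomp g h) = mvcomp (mvcomp f g) h;
  mhcompA : forall a b a' b' a'' b'' (f : T a b) (g : T a' b') (h : T a'' b''),
    mhcomp (mhcomp f g) h =
    mcast (catA a a' a'') (catA b b' b'') (mhcomp f (mhcomp g h));
  mhcomp0f : forall a b (f : T a b), mhcomp (mid0 T) f = f;
  mhcompf0 : forall a b (f : T a b),
    mhcomp f (mid0 T) = mcast (esym (cats0 a)) (esym (cats0 b)) f;
  mvcomp1f : forall a b (f : T a b), mvcomp (midl T b) f = f;
  mvcompf1 : forall a b (f : T a b), mvcomp f (midl T a) = f;
  mvcomp_hcomp : forall a b c a' b' c'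
      (f : T b c) (g : T a b) (f' : T b' c') (g' : T a' b'),
    mhcomp (mvcomp f g) (mvcomp f' g') = mvcomp (mhcomp f f') (mhcomp g g');
  mvcomp_act : forall n a (b : n.-tuple C) c
      (s : 'S_n) (f : T b c) (g : T a (permt b s)),
    mvcomp f (mcast erefl (permtK b s) (mract g s)) = mvcomp (mlact f s) g;
  mlact_vcomp : forall n (a : n.-tuple C) b c (f : T b c) (g : T a b) (s : 'S_n),
    mlact (mvcomp f g) s = mvcomp f (mlact g s);
  mract_vcomp : forall m a b (c : m.-tuple C) (f : T b c) (g : T a b) (s : 'S_m),
    mract (mvcomp f g) s = mvcomp (mract f s) g;
  mlact_hcomp : forall n p (a : n.-tuple C) (a' : p.-tuple C) b b'
      (f : T a b) (g : T a' b') (s : 'S_n) (t : 'S_p),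
    mhcomp (mlact f s) (mlact g t) =
    mcast (esym (permt_cat a a' s t)) erefl
      (mlact (a := cat_tuple a a') (mhcomp f g) (psum s t));
  mract_hcomp : forall m q a a' (b : m.-tuple C) (b' : q.-tuple C)
      (f : T a b) (g : T a' b') (s : 'S_m) (t : 'S_q),
    mhcomp (mract f s) (mract g t) =
    mcast erefl (esym (permt_catV b b' s t))
      (mract (b := cat_tuple b b') (mhcomp f g) (psum s t));
  mhcompC : forall n m p q (a : n.-tuple C) (b : m.-tuple C)
      (a' : p.-tuple C) (b' : q.-tuple C) (f : T a b) (g : T a' b'),
    mcast (permt_bswap a a') (permt_bswapV b b')
      (mlact (a := cat_tuple a a')
         (mract (b := cat_tuple b b') (mhcomp f g)
            (cast_perm (addnC q m) (bswap q m)))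
         (bswap n p)) =
    mhcomp g f;
  mlact_ract : forall n m (a : n.-tuple C) (b : m.-tuple C) (f : T a b)
      (s : 'S_n) (t : 'S_m),
    mlact (mract f t) s = mract (mlact f s) t;
  mlactM : forall n (a : n.-tuple C) b (f : T a b) (s t : 'S_n),
    mlact (mlact f t) s = mcast (esym (permt_mul a s t)) erefl (mlact f (s * t)%g);
  mractM : forall m a (b : m.-tuple C) (f : T a b) (s t : 'S_m),
    mract (mract f t) s = mcast erefl (permt_mulV b s t) (mract f (t * s)%g);
  mlact1 : forall n (a : n.-tuple C) b (f : T a b),
    mlact f 1%g = mcast (esym (permt_id a)) erefl f;
  mract1 : forall m a (b : m.-tuple C) (f : T a b),
    mract f 1%g = mcast erefl (permt_idV b) f }.

Record prop_on (C : Type) := PropOn {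
  pon_data :> prop_data C;
  pon_axioms : prop_axioms pon_data }.

Record prop := MkProp { pcol : Type; pon : prop_on pcol }.
Definition pdata (T : prop) : prop_data (pcol T) := pon T.
Coercion pdata : prop >-> prop_data.

Record prop_hom (R T : prop) := PropHom {
  hcol :> pcol R -> pcol T;
  hmor : forall a b, R a b -> T (map hcol a) (map hcol b);
  hmor_id : forall c, hmor (mid R c) = mid T (hcol c);
  hmor_id0 : hmor (mid0 R) = mid0 T;
  hmor_vcomp : forall a b c (f : R b c) (g : R a b),
    hmor (mvcomp f g) = mvcomp (hmor f) (hmor g);
  hmor_hcomp : forall a b a' b' (f : R a b) (g : R a' b'),
    hmor (mhcomp f g) =
    mcast (esym (map_cat hcol a a')) (esym (map_cat hcol b b'))
      (mhcomp (hmor f) (hmor g));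
  hmor_lact : forall n (a : n.-tuple (pcol R)) b (f : R a b) (s : 'S_n),
    hmor (mlact f s) =
    mcast (permt_map hcol a s) erefl
      (mlact (a := map_tuple hcol a) (hmor f) s);
  hmor_ract : forall m a (b : m.-tuple (pcol R)) (f : R a b) (s : 'S_m),
    hmor (mract f s) =
    mcast erefl (permt_map hcol b s^-1%g)
      (mract (b := map_tuple hcol b) (hmor f) s) }.

(* Equality of [mtot]s is equality of operations up to [mcast]. *)
Definition mtot C (T : seq C -> seq C -> Type) a b (f : T a b) :
  {p : seq C * seq C & T p.1 p.2} := existT _ (a, b) f.

Lemma mtot_cast C (T : seq C -> seq C -> Type) a a' b b' (ea : a = a')
  (eb : b = b') (f : T a b) : mtot (mcast ea eb f) = mtot f.
Proof. by case: _ / ea; case: _ / eb. Qed.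

Lemma mtotP C (T : seq C -> seq C -> Type) a a' b b' (f : T a b) (f' : T a' b') :
  mtot f = mtot f' -> exists ea eb, f' = mcast ea eb f.
Proof.
move=> e; have [ea eb] : a = a' /\ b = b' by have [-> ->] := congr1 tag e.
exists ea, eb; case: _ / ea f' e => f'; case: _ / eb f' => f' e.
have := projT2_eq e; rewrite (Prop_irrelevance (projT1_eq e) erefl) /=.
by move=> <-.
Qed.

Lemma mtot_inj C (T : seq C -> seq C -> Type) a b (f f' : T a b) :
  mtot f = mtot f' -> f = f'.
Proof.
move=> e; have [ea [eb ->]] := mtotP e.
by rewrite (Prop_irrelevance ea erefl) (Prop_irrelevance eb erefl).
Qed.

Lemma mtot_vcomp C (T : prop_data C) a b c (f : T b c) (g : T a b) a' b' c'
    (f' : T b' c') (g' : T a' b') :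
  mtot f = mtot f' -> mtot g = mtot g' -> mtot (mvcomp f g) = mtot (mvcomp f' g').
Proof.
move=> e e'; have [eb [ec ->]] := mtotP e; have [ea [eb' ->]] := mtotP e'.
case: _ / ec; case: _ / ea; case: _ / eb eb' => eb'.
by rewrite (Prop_irrelevance eb' erefl).
Qed.

Lemma mtot_hcomp C (T : prop_data C) a b c d (f : T a b) (g : T c d) a' b' c' d'
    (f' : T a' b') (g' : T c' d') :
  mtot f = mtot f' -> mtot g = mtot g' -> mtot (mhcomp f g) = mtot (mhcomp f' g').
Proof.
move=> e e'; have [ea [eb ->]] := mtotP e; have [ec [ed ->]] := mtotP e'.
by case: _ / ea; case: _ / eb; case: _ / ec; case: _ / ed.
Qed.

Lemma mtot_lact C (T : prop_data C) n (a a' : n.-tuple C) b b' (f : T a b)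
    (f' : T a' b') (s : 'S_n) :
  mtot f = mtot f' -> mtot (mlact f s) = mtot (mlact f' s).
Proof.
move=> e; have [ea [eb ->]] := mtotP e; move/val_inj: (ea) => eaa.
by subst a'; case: _ / eb; rewrite (Prop_irrelevance ea erefl).
Qed.

Lemma mtot_ract C (T : prop_data C) m a a' (b b' : m.-tuple C) (f : T a b)
    (f' : T a' b') (s : 'S_m) :
  mtot f = mtot f' -> mtot (mract f s) = mtot (mract f' s).
Proof.
move=> e; have [ea [eb ->]] := mtotP e; move/val_inj: (eb) => ebb.
by subst b'; case: _ / ea; rewrite (Prop_irrelevance eb erefl).
Qed.

Lemma mtot_hmor (R T : prop) (h : prop_hom R T) a b a' b' (f : R a b)
    (f' : R a' b') : mtot f = mtot f' -> mtot (hmor h f) = mtot (hmor h f').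
Proof. by move=> e; have [ea [eb ->]] := mtotP e; case: _ / ea; case: _ / eb. Qed.

Lemma prop_hom_ext (R T : prop) (g h : prop_hom R T) : g =1 h ->
  (forall a b (f : R a b), mtot (hmor g f) = mtot (hmor h f)) -> g = h.
Proof.
case: g h => [g mg ? ? ? ? ? ?] [h mh ? ? ? ? ? ?] /= /funext egh; subst h.
move=> e; have em : mg = mh.
  apply: functional_extensionality_dep => a.
  apply: functional_extensionality_dep => b.
  by apply: funext => f; apply: mtot_inj.
by subst mh; congr PropHom; apply: Prop_irrelevance.
Qed.

#[local] Obligation Tactic := intros.

Section PropCategory.

Variables (Q R T : prop).

Definition prop_idm_mor a b (f : T a b) : T (map id a) (map id b) :=
  mcast (esym (map_id a)) (esym (map_id b)) f.

Program Definition prop_idm : prop_hom T T := @PropHom T T id prop_idm_mor _ _ _ _ _ _.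
Next Obligation. by apply: mtot_inj; rewrite !mtot_cast. Qed.
Next Obligation. by apply: mtot_inj; rewrite !mtot_cast. Qed.
Next Obligation.
by apply: mtot_inj; rewrite !mtot_cast; apply: mtot_vcomp; rewrite mtot_cast.
Qed.
Next Obligation.
by apply: mtot_inj; rewrite !mtot_cast; apply: mtot_hcomp; rewrite mtot_cast.
Qed.
Next Obligation.
by apply: mtot_inj; rewrite !mtot_cast; apply: mtot_lact; rewrite mtot_cast.
Qed.
Next Obligation.
by apply: mtot_inj; rewrite !mtot_cast; apply: mtot_ract; rewrite mtot_cast.
Qed.

Definition prop_comp_mor (h : prop_hom R T) (g : prop_hom Q R) a b (f : Q a b) :
    T (map (h \o g) a) (map (h \o g) b) :=
  mcast (esym (map_comp h g a)) (esym (map_comp h g b)) (hmor h (hmor g f)).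

Program Definition prop_comp (h : prop_hom R T) (g : prop_hom Q R) : prop_hom Q T :=
  @PropHom Q T (h \o g) (prop_comp_mor h g) _ _ _ _ _ _.
Next Obligation. by apply: mtot_inj; rewrite !mtot_cast !hmor_id. Qed.
Next Obligation. by apply: mtot_inj; rewrite !mtot_cast !hmor_id0. Qed.
Next Obligation.
apply: mtot_inj; rewrite !mtot_cast !hmor_vcomp.
by apply: mtot_vcomp; rewrite mtot_cast.
Qed.
Next Obligation.
apply: mtot_inj; rewrite !mtot_cast hmor_hcomp (mtot_hmor _ (mtot_cast _ _ _)).
by rewrite hmor_hcomp mtot_cast; apply: mtot_hcomp; rewrite mtot_cast.
Qed.
Next Obligation.
apply: mtot_inj; rewrite !mtot_cast hmor_lact (mtot_hmor _ (mtot_cast _ _ _)).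
rewrite (@hmor_lact _ _ h n (map_tuple g a)) mtot_cast.
by apply: mtot_lact; rewrite mtot_cast.
Qed.
Next Obligation.
apply: mtot_inj; rewrite !mtot_cast hmor_ract (mtot_hmor _ (mtot_cast _ _ _)).
rewrite (@hmor_ract _ _ h m _ (map_tuple g b)) mtot_cast.
by apply: mtot_ract; rewrite mtot_cast.
Qed.

End PropCategory.

Program Definition Prop_cat : category :=
  @Category prop prop_hom prop_idm prop_comp _ _ _.
Next Obligation.
apply: prop_hom_ext => // a b x; rewrite !mtot_cast.
by rewrite (mtot_hmor _ (mtot_cast _ _ _)).
Qed.
Next Obligation. by apply: prop_hom_ext => // a b x; rewrite !mtot_cast. Qed.
Next Obligation.
apply: prop_hom_ext => // a b x; rewrite !mtot_cast.
exact: mtot_hmor (mtot_cast _ _ _).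
Qed.

(* [ocomp g f] is gamma (g, <f_i>) and [oact f s] is s^* f. *)
Record operad_data := OperadData {
  ocol : Type;
  op :> seq ocol -> ocol -> Type;
  oid : forall c, op [:: c] c;
  ocomp : forall n (b : 'I_n -> ocol) c (a : 'I_n -> seq ocol),
    op (lst b) c -> (forall i, op (a i) (b i)) -> op (lcat a) c;
  oact : forall n (a : n.-tuple ocol) c, op a c -> forall s : 'S_n,
    op (permt a s) c }.
Arguments oid : clear implicits.
Arguments ocomp {o n b c a} g f : rename.
Arguments oact {o n a c} f s : rename.

Record operad_axioms (O : operad_data) : Prop := OperadAxioms {
  ocomp1f : forall a c (f : O a c),
    ocomp (b := fun _ : 'I_1 => c) (oid O c) (fun _ => f) =
    ocast (esym (cats0 a)) f;
  ocompf1 : forall n (b : 'I_n -> ocol O) c (g : O (lst b) c),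
    ocomp g (fun i => oid O (b i)) = g;
  ocompA : forall n (k : 'I_n -> nat) (b : 'I_n -> ocol O) c
      (a : forall i, 'I_(k i) -> ocol O) (x : forall i, 'I_(k i) -> seq (ocol O))
      (g : O (lst b) c) (f : forall i, O (lst (a i)) (b i))
      (h : forall i j, O (x i j) (a i j)),
    ocomp (ocast (lst_sig a) (ocomp g f))
      (fun q : 'I_(\sum_i k i) => h (tagnat.sig1 q) (tagnat.sig2 q)) =
    ocast (lcat_sig x) (ocomp g (fun i => ocomp (f i) (h i)));
  ocomp_actl : forall n (k : 'I_n -> nat) (b : 'I_n -> ocol O) c
      (a : forall i, (k i).-tuple (ocol O)) (g : O (lst b) c)
      (f : forall i, O (a i) (b i)) (s : 'S_n),
    ocomp (ocast (permt_lst b s) (oact (a := lst_tuple b) g s))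
      (fun i => f (s i)) =
    ocast (esym (permt_pblock a s))
      (oact (a := lcat_tuple a) (ocomp g f) (pblock k s));
  ocomp_actr : forall n (k : 'I_n -> nat) (b : 'I_n -> ocol O) c
      (a : forall i, (k i).-tuple (ocol O)) (g : O (lst b) c)
      (f : forall i, O (a i) (b i)) (s : forall i, 'S_(k i)),
    ocomp g (fun i => oact (f i) (s i)) =
    ocast (esym (permt_pdiag a s))
      (oact (a := lcat_tuple a) (ocomp g f) (pdiag s));
  oactM : forall n (a : n.-tuple (ocol O)) c (f : O a c) (s t : 'S_n),
    oact (oact f t) s = ocast (esym (permt_mul a s t)) (oact f (s * t)%g);
  oact1 : forall n (a : n.-tuple (ocol O)) c (f : O a c),
    oact f 1%g = ocast (esym (permt_id a)) f }.

Record operad := MkOperad {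
  odata :> operad_data;
  oaxioms : operad_axioms odata }.

Record operad_hom (O P : operad_data) := OperadHom {
  ohcol :> ocol O -> ocol P;
  ohop : forall a c, O a c -> P (map ohcol a) (ohcol c);
  ohop_id : forall c, ohop (oid O c) = oid P (ohcol c);
  ohop_comp : forall n (b : 'I_n -> ocol O) c (a : 'I_n -> seq (ocol O))
      (g : O (lst b) c) (f : forall i, O (a i) (b i)),
    ohop (ocomp g f) =
    ocast (esym (map_lcat ohcol a))
      (ocomp (b := ohcol \o b) (ocast (map_lst ohcol b) (ohop g))
        (fun i => ohop (f i)));
  ohop_act : forall n (a : n.-tuple (ocol O)) c (f : O a c) (s : 'S_n),
    ohop (oact f s) =
    ocast (permt_map ohcol a s) (oact (a := map_tuple ohcol a) (ohop f) s) }.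

Definition otot C (O : seq C -> C -> Type) a c (f : O a c) : {a : seq C & O a c} :=
  existT _ a f.

Lemma otot_cast C (O : seq C -> C -> Type) a a' c (e : a = a') (f : O a c) :
  otot (ocast e f) = otot f.
Proof. by case: _ / e. Qed.

Lemma ototP C (O : seq C -> C -> Type) a a' c (f : O a c) (f' : O a' c) :
  otot f = otot f' -> exists e, f' = ocast e f.
Proof.
move=> e; have ea : a = a' := projT1_eq e; exists ea.
case: _ / ea f' e => f' e; have := projT2_eq e.
by rewrite (Prop_irrelevance (projT1_eq e) erefl) /= => <-.
Qed.

Lemma otot_inj C (O : seq C -> C -> Type) a c (f f' : O a c) :
  otot f = otot f' -> f = f'.
Proof.
by move=> e; have [ea ->] := ototP e; rewrite (Prop_irrelevance ea erefl).
Qed.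

Lemma otot_comp (O : operad_data) n (b : 'I_n -> ocol O) c
    (a a' : 'I_n -> seq (ocol O)) (g g' : O (lst b) c)
    (f : forall i, O (a i) (b i)) (f' : forall i, O (a' i) (b i)) :
  otot g = otot g' -> (forall i, otot (f i) = otot (f' i)) ->
  otot (ocomp g f) = otot (ocomp g' f').
Proof.
move=> eg e; rewrite -(otot_inj eg).
have ea : a = a' by apply: funext => i; exact: projT1_eq (e i).
subst a'; suff -> : f = f' by [].
by apply: functional_extensionality_dep => i; apply: otot_inj.
Qed.

Lemma otot_act (O : operad_data) n (a a' : n.-tuple (ocol O)) c (f : O a c)
    (f' : O a' c) (s : 'S_n) :
  otot f = otot f' -> otot (oact f s) = otot (oact f' s).
Proof.
move=> e; have [ea ->] := ototP e; move/val_inj: (ea) => eaa.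
by subst a'; rewrite (Prop_irrelevance ea erefl).
Qed.

Lemma otot_ohop (O P : operad_data) (h : operad_hom O P) a a' c (f : O a c)
    (f' : O a' c) : otot f = otot f' -> otot (ohop h f) = otot (ohop h f').
Proof. by move=> e; have [ea ->] := ototP e; case: _ / ea. Qed.

Lemma operad_hom_ext (O P : operad_data) (h : ocol O -> ocol P) mg mh
    g1 g2 g3 h1 h2 h3 :
  (forall a c (f : O a c), otot (mg a c f) = otot (mh a c f)) ->
  @OperadHom O P h mg g1 g2 g3 = @OperadHom O P h mh h1 h2 h3.
Proof.
move=> e; have em : mg = mh.
  apply: functional_extensionality_dep => a.
  apply: functional_extensionality_dep => c.
  by apply: funext => f; apply: otot_inj.
by subst mh; congr OperadHom; apply: Prop_irrelevance.
Qed.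

Section OperadCategory.

Variables (N O P : operad_data).

Definition operad_idm_op a c (f : O a c) : O (map id a) c :=
  ocast (esym (map_id a)) f.

Program Definition operad_idm : operad_hom O O :=
  @OperadHom O O id operad_idm_op _ _ _.
Next Obligation. by apply: otot_inj; rewrite otot_cast. Qed.
Next Obligation.
apply: otot_inj; rewrite !otot_cast; apply: otot_comp => [|i].
  by rewrite !otot_cast.
by rewrite otot_cast.
Qed.
Next Obligation.
by apply: otot_inj; rewrite !otot_cast; apply: otot_act; rewrite otot_cast.
Qed.

Definition operad_comp_op (h : operad_hom O P) (g : operad_hom N O) a c
    (f : N a c) : P (map (h \o g) a) (h (g c)) :=
  ocast (esym (map_comp h g a)) (ohop h (ohop g f)).

Program Definition operad_comp (h : operad_hom O P) (g : operad_hom N O) :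
  operad_hom N P := @OperadHom N P (h \o g) (operad_comp_op h g) _ _ _.
Next Obligation. by apply: otot_inj; rewrite otot_cast !ohop_id. Qed.
Next Obligation.
apply: otot_inj; rewrite !otot_cast ohop_comp (otot_ohop _ (otot_cast _ _)).
rewrite ohop_comp otot_cast; apply: otot_comp => [|i]; rewrite !otot_cast //.
by rewrite (otot_ohop _ (otot_cast _ _)).
Qed.
Next Obligation.
apply: otot_inj; rewrite !otot_cast ohop_act (otot_ohop _ (otot_cast _ _)).
rewrite (@ohop_act _ _ h n (map_tuple g a)) otot_cast.
by apply: otot_act; rewrite otot_cast.
Qed.

End OperadCategory.

Program Definition Operad_cat : category :=
  @Category operad (fun O P => operad_hom O P) (fun O => operad_idm O)
    (fun N O P => @operad_comp N O P) _ _ _.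
Next Obligation.
apply: operad_hom_ext => a c x; rewrite !otot_cast.
by rewrite (otot_ohop _ (otot_cast _ _)).
Qed.
Next Obligation.
by case: f => h mh *; apply: operad_hom_ext => a c x; rewrite !otot_cast.
Qed.
Next Obligation.
case: f => h mh h1 h2 h3; apply: operad_hom_ext => a c x; rewrite !otot_cast.
exact: (otot_ohop (OperadHom h1 h2 h3) (otot_cast _ _)).
Qed.

Definition forget_data (T : prop) : operad_data :=
  @OperadData (pcol T) (fun a c => T a [:: c]) (mid T)
    (fun n b c a g f => mvcomp g (mhcat (b := fun i => [:: b i]) f))
    (fun n a c f s => mlact f s).

Lemma mtot_mhcat C (T : prop_data C) n (a b a' b' : 'I_n -> seq C)
    (f : forall i, T (a i) (b i)) (f' : forall i, T (a' i) (b' i)) :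
  (forall i, mtot (f i) = mtot (f' i)) -> mtot (mhcat f) = mtot (mhcat f').
Proof.
elim: n a b a' b' f f' => // n IH a b a' b' f f' e.
by apply: mtot_hcomp => //; apply: IH.
Qed.

Lemma hmor_mhcat (R T : prop) (h : prop_hom R T) n
    (a b : 'I_n -> seq (pcol R)) (f : forall i, R (a i) (b i)) :
  mtot (hmor h (mhcat f)) = mtot (mhcat (fun i => hmor h (f i))).
Proof.
elim: n a b f => [|n IH] a b f; first by rewrite /= hmor_id0.
by rewrite /= hmor_hcomp mtot_cast; apply: mtot_hcomp.
Qed.

Lemma otot_mtot (T : prop) a a' c (f : forget_data T a c)
    (f' : forget_data T a' c) :
  mtot (f : T a [:: c]) = mtot (f' : T a' [:: c]) -> otot f = otot f'.
Proof.
move=> e; have [ea [eb ->]] := mtotP e.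
by case: _ / ea; rewrite (Prop_irrelevance eb erefl).
Qed.

Lemma mtot_ocast (T : prop) a a' c (e : a = a') (f : forget_data T a c) :
  mtot (ocast e f : T a' [:: c]) = mtot (f : T a [:: c]).
Proof. by case: _ / e. Qed.

Program Definition forget_hom (R T : prop) (h : prop_hom R T) :
    operad_hom (forget_data R) (forget_data T) :=
  @OperadHom (forget_data R) (forget_data T) h
    (fun a c f => hmor h (f : R a [:: c])) _ _ _.
Next Obligation. exact: hmor_id. Qed.
Next Obligation.
apply/otot_inj/otot_mtot; rewrite mtot_ocast /= hmor_vcomp.
apply: mtot_vcomp; first by rewrite mtot_ocast.
exact: hmor_mhcat.
Qed.
Next Obligation.
apply/otot_inj/otot_mtot; rewrite mtot_ocast /= hmor_lact mtot_cast.
exact: mtot_lact.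
Qed.

Section ForgetAxioms.

Variables (T : prop).
Let C := pcol T.
Let ax : prop_axioms (pon T) := pon_axioms (pon T).
Let M := {p : seq C * seq C & T p.1 p.2}.
Let one : M := mtot (mid0 T).
Let hc (x y : M) : M := mtot (mhcomp (tagged x) (tagged y)).
Let H := foldr hc one.

Lemma hc_mtot a b a' b' (f : T a b) (g : T a' b') :
  hc (mtot f) (mtot g) = mtot (mhcomp f g).
Proof. by []. Qed.

Lemma hcA : associative hc.
Proof.
case=> [[a b] /= f] [[a' b'] /= g] [[a'' b''] /= h].
by rewrite /hc /= (mhcompA ax) mtot_cast.
Qed.

Lemma hc1 x : hc x one = x.
Proof. by case: x => [[a b] /= f]; rewrite /hc (mhcompf0 ax) mtot_cast. Qed.

Lemma h1c x : hc one x = x.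
Proof. by case: x => [[a b] /= f]; rewrite /hc /= (mhcomp0f ax). Qed.

Lemma H_cat l l' : H (l ++ l') = hc (H l) (H l').
Proof. by elim: l => [|x l IH] /=; rewrite ?h1c // IH hcA. Qed.

Lemma mhcatE n (a b : 'I_n -> seq C) (f : forall i, T (a i) (b i)) :
  mtot (mhcat f) = H (lst (fun i => mtot (f i))).
Proof.
elim: n a b f => // n IH a b f /=.
by rewrite -hc_mtot IH.
Qed.

Lemma H_lcat n (L : 'I_n -> seq M) : H (lcat L) = H (lst (fun i => H (L i))).
Proof. by elim: n L => // n IH L /=; rewrite H_cat IH. Qed.

Lemma mvcomp_mhcat n (a b c : 'I_n -> seq C) (f : forall i, T (b i) (c i))
    (g : forall i, T (a i) (b i)) :
  mvcomp (mhcat f) (mhcat g) = mhcat (fun i => mvcomp (f i) (g i)).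
Proof.
elim: n a b c f g => [|n IH] a b c f g /=.
  exact: (mvcomp1f ax (mid0 T)).
by rewrite -(mvcomp_hcomp ax) IH.
Qed.

Lemma mhcat_id n (b : 'I_n -> C) :
  mhcat (b := fun i => [:: b i]) (fun i => mid T (b i)) = midl T (lst b).
Proof. by elim: n b => // n IH b; rewrite /= IH. Qed.

(* Permutations of inputs and outputs are tracked through lists of labels. *)
Definition relab X Y (x : M) (L : seq X) (B : seq Y) (y : M)
    (L' : seq X) (B' : seq Y) : Prop :=
  exists n m (a : n.-tuple C) (b : m.-tuple C) (f : T a b)
    (la : n.-tuple X) (lb : m.-tuple Y) (s : 'S_n) (t : 'S_m),
  [/\ x = mtot f, y = mtot (mlact (mract f t) s),
      L = la /\ B = lb & L' = permt la s /\ B' = permt lb t^-1%g].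

Lemma mtot_act1 n m (a : n.-tuple C) (b : m.-tuple C) (f : T a b) :
  mtot (mlact (mract f 1%g) 1%g) = mtot f.
Proof. by rewrite (mlact1 ax) mtot_cast (mract1 ax) mtot_cast. Qed.

Lemma relab_refl X Y n m (a : n.-tuple C) (b : m.-tuple C) (f : T a b)
    (la : n.-tuple X) (lb : m.-tuple Y) :
  relab (mtot f) la lb (mtot f) la lb.
Proof.
exists n, m, a, b, f, la, lb, 1%g, 1%g; split=> //; first by rewrite mtot_act1.
by rewrite permt_id -permt_idV.
Qed.

Lemma relab_trans X Y x (L : seq X) (B : seq Y) y L' B' z L'' B'' :
  relab x L B y L' B' -> relab y L' B' z L'' B'' -> relab x L B z L'' B''.
Proof.
case=> [n [m [a [b [f [la [lb [s [t [-> -> [-> ->] [-> ->]]]]]]]]]]].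
case=> [n' [m' [a' [b' [f' [la' [lb' [s' [t' []]]]]]]]]].
move=> ef -> [ela elb] [-> ->].
have en : n' = n by rewrite -(size_tuple la') -ela size_tuple.
have em : m' = m by rewrite -(size_tuple lb') -elb size_tuple.
subst n' m'; have {ela} <- := val_inj ela; have {elb} <- := val_inj elb.
exists n, m, a, b, f, la, lb, (s' * s)%g, (t * t')%g; split=> //; last first.
  by rewrite permt_mul -permt_mulV.
rewrite (mtot_lact _ (mtot_ract _ (esym ef))) -(mtot_lact _ (congr1 _ (mlact_ract ax _ _ _))).
rewrite (mlactM ax) mtot_cast; apply: mtot_lact.
by rewrite (mractM ax) mtot_cast.
Qed.

Lemma relab_hc X Y x (L : seq X) (B : seq Y) y L' B' x1 L1 B1 y1 L1' B1' :
  relab x L B y L' B' -> relab x1 L1 B1 y1 L1' B1' ->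
  relab (hc x x1) (L ++ L1) (B ++ B1) (hc y y1) (L' ++ L1') (B' ++ B1').
Proof.
case=> [n [m [a [b [f [la [lb [s [t [-> -> [-> ->] [-> ->]]]]]]]]]]].
case=> [p [q [c [d [g [lc [ld [s' [t' [-> -> [-> ->] [-> ->]]]]]]]]]]].
exists (n + p), (m + q), (cat_tuple a c), (cat_tuple b d), (mhcomp f g).
exists (cat_tuple la lc), (cat_tuple lb ld), (psum s s'), (psum t t').
split=> //; last by rewrite permt_cat permt_catV.
rewrite hc_mtot (mlact_hcomp ax) mtot_cast; apply: mtot_lact.
by rewrite (mract_hcomp ax) mtot_cast.
Qed.

Lemma relab_swap X Y n m (a : n.-tuple C) (b : m.-tuple C) (f : T a b)
    (la : n.-tuple X) (lb : m.-tuple Y)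
    p q (c : p.-tuple C) (d : q.-tuple C) (g : T c d)
    (lc : p.-tuple X) (ld : q.-tuple Y) :
  relab (hc (mtot f) (mtot g)) (la ++ lc) (lb ++ ld)
    (hc (mtot g) (mtot f)) (lc ++ la) (ld ++ lb).
Proof.
exists (n + p), (m + q), (cat_tuple a c), (cat_tuple b d), (mhcomp f g).
exists (cat_tuple la lc), (cat_tuple lb ld), (bswap n p).
exists (cast_perm (addnC q m) (bswap q m)); split=> //.
  by rewrite hc_mtot -(mhcompC ax) mtot_cast.
by rewrite permt_bswap permt_bswapV.
Qed.

Lemma permt_inj (X : eqType) n (a : n.-tuple X) : uniq a -> injective (permt a).
Proof.
move=> ua s t e; apply/permP => i; apply: val_inj.
have := congr1 (fun u => tnth u i) e; rewrite !tnth_mktuple.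
have := tnth a i; move=> x0; rewrite !(tnth_nth x0) => /eqP; rewrite nth_uniq ?size_tuple //.
by move/eqP.
Qed.

Lemma relab_fun (X Y : eqType) n m (a : n.-tuple C) (b : m.-tuple C) (f : T a b)
    (la : n.-tuple X) (lb : m.-tuple Y) (s : 'S_n) (t : 'S_m) y :
  uniq la -> uniq lb ->
  relab (mtot f) la lb y (permt la s) (permt lb t) ->
  y = mtot (mlact (mract f t^-1%g) s).
Proof.
move=> ua ub [n' [m' [a' [b' [f' [la' [lb' [s' [t' []]]]]]]]]].
move=> ef -> [ela elb] [els elt].
have en : n' = n by rewrite -(size_tuple la') -ela size_tuple.
have em : m' = m by rewrite -(size_tuple lb') -elb size_tuple.
subst n' m'; move: els elt; rewrite -(val_inj ela) -(val_inj elb).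
move=> /val_inj/(permt_inj ua) <- /val_inj/(permt_inj ub) et.
have {et} -> : t' = t^-1%g by rewrite et invgK.
by apply/mtot_lact/mtot_ract.
Qed.

Lemma perm_Permutation (X : eqType) (l l' : seq X) :
  perm_eq l l' -> Permutation l l'.
Proof.
elim: l l' => [|x l IH] l' e.
  by move: e; rewrite perm_sym => /perm_nilP ->; constructor.
have xl : x \in l' by rewrite -(perm_mem e) mem_head.
case/splitPr: xl e => l1 l2 e.
apply: Permutation_cons_app; apply: IH.
rewrite -(perm_cons x); apply: perm_trans e _.
exact/permEl/(perm_catCA l1 [:: x] l2).
Qed.

Lemma relab_perm (I : Type) (x : I -> M) X Y (L : I -> seq X) (B : I -> seq Y) :
  (forall i, size (L i) = size (tag (x i)).1) ->
  (forall i, size (B i) = size (tag (x i)).2) ->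
  forall r r', Permutation r r' ->
  relab (H [seq x i | i <- r]) (flatten [seq L i | i <- r])
                               (flatten [seq B i | i <- r])
    (H [seq x i | i <- r']) (flatten [seq L i | i <- r'])
                            (flatten [seq B i | i <- r']).
Proof.
move=> sL sB; have rf i : exists n m (a : n.-tuple C) (b : m.-tuple C) (f : T a b)
    (la : n.-tuple X) (lb : m.-tuple Y),
    [/\ x i = mtot f, L i = la & B i = lb].
  move: (sL i) (sB i); case: (x i) => [[a b] /= f] /eqP ela /eqP elb.
  exists (size a), (size b), (in_tuple a), (in_tuple b), f.
  by exists (Tuple ela), (Tuple elb).
have rr i : relab (x i) (L i) (B i) (x i) (L i) (B i).
  have [n [m [a [b [f [la [lb [-> -> ->]]]]]]]] := rf i; exact: relab_refl.
have rrr r : relab (H [seq x i | i <- r]) (flatten [seq L i | i <- r])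
    (flatten [seq B i | i <- r]) (H [seq x i | i <- r])
    (flatten [seq L i | i <- r]) (flatten [seq B i | i <- r]).
  elim: r => [|i r IH] /=; last exact: relab_hc.
  exact: (relab_refl (a := [tuple]) (b := [tuple]) (mid0 T) [tuple] [tuple]).
move=> r r'; elim=> {r r'} [|i r r' _ IH|i j r|r1 r2 r3 _ IH1 _ IH2].
- exact: (rrr [::]).
- exact: relab_hc.
- rewrite /= !hcA !catA; apply: relab_hc => //.
  have [n [m [a [b [f [la [lb [-> -> ->]]]]]]]] := rf i.
  have [n' [m' [a' [b' [f' [la' [lb' [-> -> ->]]]]]]]] := rf j.
  exact: relab_swap.
- exact: relab_trans IH1 IH2.
Qed.

Section Equivariance.

Variables (n : nat) (k : 'I_n -> nat) (b : 'I_n -> C).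
Variables (a : forall i, (k i).-tuple C) (f : forall i, T (a i) [:: b i]).

Let L i := [tuple @tagnat.Rank n k i j | j < k i].
Let B (i : 'I_n) := [tuple i].

Lemma lcat_L : lcat L = enum 'I_(\sum_i k i).
Proof.
apply: (inj_map val_inj); rewrite val_enum_ord -(flatten_iota k 0) map_lcat lcatE.
congr flatten; apply: eq_map => i /=.
rewrite add0n -map_comp -[X in iota X]addn0 iotaDl -val_enum_ord -map_comp.
by apply: eq_map => j /=; exact/tagnat.RankEsum.
Qed.

Lemma uniq_L : uniq (lcat_tuple L).
Proof. by rewrite /= lcat_L enum_uniq. Qed.

Lemma uniq_B : uniq (lst_tuple (@id 'I_n)).
Proof. by rewrite /= lstE map_id enum_uniq. Qed.

Lemma mhcat_pblock (s : 'S_n) :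
  mtot (mhcat (b := fun i => [:: b (s i)]) (fun i => f (s i))) =
  mtot (mlact (a := lcat_tuple a)
          (mract (b := lst_tuple b) (mhcat f) s^-1%g) (pblock k s)).
Proof.
apply: (relab_fun uniq_L uniq_B).
rewrite -permt_pblock permt_lst /= (mhcatE f) (mhcatE (fun i => f (s i))).
rewrite !lstE !lcatE map_id; set e := enum 'I_n.
have pe : Permutation e (map s e).
  apply/perm_Permutation/uniq_perm; rewrite ?(map_inj_uniq perm_inj) ?enum_uniq //.
  move=> i; rewrite mem_enum; apply/esym/mapP; exists (s^-1%g i).
    by rewrite mem_enum.
  by rewrite permKV.
have := @relab_perm _ (fun i => mtot (f i)) _ _ (fun i => L i)
  (fun i => [:: i]) _ _ _ _ pe.
rewrite !flatten_seq1 -(map_comp (fun i => mtot (f i)) s).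
rewrite -(map_comp (fun i => val (L i)) s).
by apply=> i //; rewrite size_tuple /= size_tuple.
Qed.

Lemma mhcat_pdiag (s : forall i, 'S_(k i)) :
  mtot (mhcat (fun i => mlact (f i) (s i))) =
  mtot (mlact (a := lcat_tuple a) (mhcat f) (pdiag s)).
Proof.
transitivity (mtot (mlact (a := lcat_tuple a)
          (mract (b := lst_tuple b) (mhcat f) 1^-1%g) (pdiag s))); last first.
  by apply: mtot_lact; rewrite invg1 (mract1 ax) mtot_cast.
apply: (relab_fun uniq_L uniq_B).
rewrite permt_id -permt_pdiag !mhcatE /= /lst !lcatE.
elim: (enum 'I_n) => [|i r IH] /=.
  exact: (relab_refl (a := [tuple]) (b := [tuple]) (mid0 T) [tuple] [tuple]).
suff R : relab (mtot (f i)) (L i) [:: i] (mtot (mlact (f i) (s i)))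
    (permt (L i) (s i)) [:: i] by exact: (relab_hc R IH).
exists (k i), 1, (a i), [tuple b i], (f i).
exists (L i), (B i), (s i), 1%g; split=> //.
  apply: mtot_lact; rewrite (@mract1 _ _ ax _ _ [tuple b i]).
  by rewrite mtot_cast.
by rewrite -permt_idV.
Qed.

End Equivariance.

Lemma forget_axioms : operad_axioms (forget_data T).
Proof.
split=> [a c f|n b c g|n k b c a x g f h|n k b c a g f s|n k b c a g f s
        |n a c f s t|n a c f].
- apply/otot_inj/otot_mtot; rewrite mtot_ocast /=.
  rewrite -[in RHS](mvcomp1f ax (f : T a [:: c])); apply: mtot_vcomp.
    by rewrite /= (mhcompf0 ax) mtot_cast.
  by rewrite (mhcompf0 ax) mtot_cast.
- by rewrite /= mhcat_id (mvcompf1 ax).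
- apply/otot_inj/otot_mtot; rewrite mtot_ocast /=.
  rewrite -mvcomp_mhcat (mvcompA ax); apply: mtot_vcomp.
    by rewrite mtot_ocast.
  rewrite !mhcatE -(lst_sig (fun i j => mtot (h i j : T (x i j) [:: a i j]))).
  by rewrite H_lcat; congr (H _); rewrite !lstE; apply: eq_map => i; rewrite mhcatE.
- apply/otot_inj/otot_mtot; rewrite mtot_ocast /= (mlact_vcomp ax).
  pose G := mlact (a := lcat_tuple a)
    (mract (b := lst_tuple b) (mhcat f) s^-1%g) (pblock k s).
  have eb : permt (lst_tuple b) s^-1^-1%g = permt (lst_tuple b) s :> seq _.
    by rewrite invgK.
  have e := mvcomp_act ax (b := lst_tuple b) (s := s) g (mcast erefl eb G).
  transitivity (mtot (mvcomp (mlact (a := lst_tuple b) g s) (mcast erefl eb G))).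
    apply: mtot_vcomp; first by rewrite mtot_ocast.
    by rewrite mtot_cast mhcat_pblock.
  rewrite -e; apply: mtot_vcomp => //; rewrite mtot_cast.
  have -> : mtot (mract (mcast erefl eb G) s) = mtot (mract G s).
    by apply: mtot_ract; rewrite mtot_cast.
  rewrite /G -(mlact_ract ax); apply: mtot_lact.
  by rewrite (mractM ax) mtot_cast mulVg (mract1 ax) mtot_cast.
- apply/otot_inj/otot_mtot; rewrite mtot_ocast /= (mlact_vcomp ax).
  by apply: mtot_vcomp => //; apply: mhcat_pdiag.
- by apply/otot_inj/otot_mtot; rewrite mtot_ocast /= (mlactM ax) mtot_cast.
- by apply/otot_inj/otot_mtot; rewrite mtot_ocast /= (mlact1 ax) mtot_cast.
Qed.

End ForgetAxioms.

Definition forget_obj (T : Prop_cat) : Operad_cat := MkOperad (forget_axioms T).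

Program Definition forget : functor Prop_cat Operad_cat :=
  Functor (@FunctorOn Prop_cat Operad_cat forget_obj forget_hom _ _).
Next Obligation.
apply: operad_hom_ext => a c x.
by apply: otot_mtot; rewrite mtot_cast mtot_ocast.
Qed.
Next Obligation.
apply: operad_hom_ext => a c x.
by apply: otot_mtot; rewrite mtot_cast mtot_ocast.
Qed.

Definition fiber n m (theta : 'I_n -> 'I_m) (j : 'I_m) : seq 'I_n :=
  [seq i <- enum 'I_n | theta i == j].

(* Pairs (theta, <f_j>) with f_j : <a_i>_(theta i = j) -> b_j. *)
Definition free_op (O : operad_data) n m (a : n.-tuple (ocol O))
    (b : m.-tuple (ocol O)) : Type :=
  {theta : {ffun 'I_n -> 'I_m} &
   forall j, O [seq tnth a i | i <- fiber theta j] (tnth b j)}.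

Definition fibers n m (theta : 'I_n -> 'I_m) : seq 'I_n := lcat (fiber theta).

Lemma perm_fibers n m (theta : 'I_n -> 'I_m) : perm_eq (fibers theta) (enum 'I_n).
Proof.
have mem_fibers i : i \in fibers theta.
  rewrite /fibers lcatE; apply/flatten_mapP; exists (theta i).
    by rewrite mem_enum.
  by rewrite /fiber mem_filter eqxx mem_enum.
apply: uniq_perm => [||i]; rewrite ?enum_uniq ?mem_enum ?mem_fibers //.
apply/(@count_mem_uniq _ _ _) => i; rewrite mem_fibers /fibers lcatE count_flatten.
rewrite -map_comp sumnE big_map big_enum /= (bigD1 (theta i)) //= big1.
  rewrite addn0 count_uniq_mem; last exact/filter_uniq/enum_uniq.
  by rewrite /fiber mem_filter eqxx mem_enum.
move=> j neq; apply/count_memPn.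
by rewrite /fiber mem_filter eq_sym (negbTE neq).
Qed.

Lemma size_fibers n m (theta : 'I_n -> 'I_m) : size (fibers theta) == n.
Proof. by rewrite (perm_size (perm_fibers theta)) size_enum_ord. Qed.
Canonical fibers_tuple n m (theta : 'I_n -> 'I_m) := Tuple (size_fibers theta).

(* The position of i in the concatenation of the fibers of theta. *)
Lemma unshuffle_subproof n m (theta : 'I_n -> 'I_m) i :
  index i (fibers theta) < n.
Proof.
rewrite -[X in _ < X](eqP (size_fibers theta)) index_mem.
by rewrite (perm_mem (perm_fibers theta)) mem_enum.
Qed.
Lemma unshuffle_inj n m (theta : 'I_n -> 'I_m) :
  injective (fun i => Ordinal (unshuffle_subproof theta i)).
Proof.
move=> i j [e]; rewrite -(nth_index i (s := fibers theta) (x := i)); last first.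
  by rewrite (perm_mem (perm_fibers theta)) mem_enum.
by rewrite e nth_index // (perm_mem (perm_fibers theta)) mem_enum.
Qed.
Definition unshuffle n m (theta : 'I_n -> 'I_m) : 'S_n :=
  perm (@unshuffle_inj n m theta).

Lemma permt_unshuffle C n m (theta : 'I_n -> 'I_m) (a : n.-tuple C) :
  permt (map_tuple (tnth a) (fibers_tuple theta)) (unshuffle theta) = a :> seq C.
Proof.
congr val; apply: eq_from_tnth => i; rewrite tnth_mktuple tnth_map permE.
congr tnth; rewrite (tnth_nth i) /= nth_index //.
by rewrite (perm_mem (perm_fibers theta)) mem_enum.
Qed.

Lemma lcat_fiber C D (h : C -> D) n m (theta : 'I_n -> 'I_m) (a : n.-tuple C) :
  lcat (fun j => map h [seq tnth a i | i <- fiber theta j]) =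
  map_tuple (tnth (map_tuple h a)) (fibers_tuple theta).
Proof.
rewrite /= map_lcat; congr lcat; apply: funext => j; rewrite -map_comp.
by apply: eq_map => i; rewrite /= tnth_map.
Qed.

Lemma lst_map_tnth C D (h : C -> D) m (b : m.-tuple C) :
  lst (fun j => h (tnth b j)) = map h b.
Proof. by rewrite -[in RHS](lst_tnth b) map_lst. Qed.

(* The operation u^* (eta f_0 o_h ... o_h eta f_(m-1)) of P named by the pair
   (theta, <f_j>), where u is [unshuffle theta]: the i-th input is plugged into
   f_(theta i), in increasing order of i on every fiber. *)
Definition free_op_eval (O : operad) (P : prop) (eta : operad_hom O (forget_data P))
    n m (a : n.-tuple (ocol O)) (b : m.-tuple (ocol O)) (x : free_op a b) :
    P (map eta a) (map eta b) :=
  let f j : P (map eta [seq tnth a i | i <- fiber (tag x) j]) [:: eta (tnth b j)] :=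
    ohop eta (tagged x j) in
  mcast (permt_unshuffle (tag x) (map_tuple eta a)) (lst_map_tnth eta b)
    (mlact (mcast (lcat_fiber eta (tag x) a) erefl (mhcat f))
       (unshuffle (tag x))).

(* Main.v *)
(* The operations on pairs (theta, <f_j>) are not written down. Composites of
   evaluated pairs in an arbitrary prop P are again evaluated pairs, with a pair
   that does not depend on P (permutations are tracked through labels of inputs
   and outputs); this pair is chosen as the composite. The prop axioms then
   follow from those of a single prop in which evaluation is injective. Such a
   prop consists of relations between tuples of elements of the free O-algebra
   on labelled variables: relating the tuple of distinct variables
   (x_1, ..., x_n) to (f_1(x_i)_(theta i = 1), ..., f_m(x_i)_(theta i = m))
   determines theta and the f_j. Evaluation in P is the extension of an operad
   morphism O -> U(P), and every pair is the evaluation of itself, whence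
   uniqueness. *)

From Stdlib Require Import Permutation.
Require Import Defs.
From mathcomp Require Import all_boot all_order all_fingroup.
From mathcomp Require Import boolp.
From mathcomp Require Import zify.

Set Implicit Arguments.
Unset Strict Implicit.
Unset Printing Implicit Defensive.

#[local] Obligation Tactic := idtac.

(** * The prop of relations between coloured tuples *)

(** Relations are taken between lists over one type, with colours read off by a function: a
    transport along an equality of colour lists then leaves the underlying relation unchanged,
    whereas functions between products of coloured sets would carry such transports everywhere. An
    operation of [O] acts through the graph of its action on the free algebra. The obstacle in
    composing pairs is order. Distinct variables separate pairs because the labels in the [j]-th
    value form the fiber of [theta] over [j], and distinct labels leave no nontrivial permutation to
    act on [f_j]. That a pair is its own evaluation is proved without inspecting the chosen
    composites: both sides are evaluated once more in the prop of relations, where evaluation is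
    injective. *)

Lemma as_tuple X n (x : seq X) : size x = n -> exists t : n.-tuple X, x = t.
Proof. by move/eqP => h; exists (Tuple h). Qed.

Lemma cat_eq X (x y x' y' : seq X) :
  size x = size x' -> x ++ y = x' ++ y' -> x = x' /\ y = y'.
Proof.
move=> h e; have := congr1 (take (size x)) e; have := congr1 (drop (size x)) e.
by rewrite {2 4}h !take_size_cat // !drop_size_cat.
Qed.

Lemma permtVK X n (x : n.-tuple X) (s : 'S_n) :
  permt (permt x s^-1%g) s = x :> seq X.
Proof. by rewrite permt_mul mulgV permt_id. Qed.

Lemma permt_bij X n (x y : n.-tuple X) (s : 'S_n) :
  permt x s = permt y s :> seq X -> x = y.
Proof.
move=> e; have {e} := val_inj e => e.
by apply: val_inj; rewrite /= -[LHS](permtK x s) e permtK.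
Qed.

Section RelationProp.

Variables (C V : Type) (ty : V -> C).

(** The colour lists occur only as a constraint on untyped lists, so [mcast] does not affect the
    relation and the axioms become statements about plain lists. *)
Definition rel_mor (a b : seq C) : Type :=
  {R : seq V -> seq V -> Prop | forall x y, R x y -> map ty x = a /\ map ty y = b}.

Lemma rel_mor_ext a b (R S : rel_mor a b) :
  (forall x y, sval R x y <-> sval S x y) -> R = S.
Proof.
case: R S => [R hR] [S hS] /= e.
have eRS : R = S by apply: funext => x; apply: funext => y; apply: propext.
by subst S; congr exist; apply: Prop_irrelevance.
Qed.

Lemma sval_mcast a a' b b' (ea : a = a') (eb : b = b') (R : rel_mor a b) :
  sval (mcast ea eb R) = sval R.
Proof. by case: _ / ea; case: _ / eb. Qed.

Lemma rel_size a b (R : rel_mor a b) x y :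
  sval R x y -> size x = size a /\ size y = size b.
Proof. by move/(svalP R) => [<- <-]; rewrite !size_map. Qed.

Lemma map_permt n (a : n.-tuple C) (t : n.-tuple V) (s : 'S_n) :
  map ty t = a -> map ty (permt t s) = permt a s.
Proof.
by move=> e; have <- : map_tuple ty t = a; [exact: val_inj | rewrite permt_map].
Qed.

Program Definition rel_id c : rel_mor [:: c] [:: c] :=
  exist _ (fun x y => x = y /\ map ty x = [:: c]) _.
Next Obligation. by move=> c x y [<-]. Qed.

Program Definition rel_id0 : rel_mor [::] [::] :=
  exist _ (fun x y => x = [::] /\ y = [::]) _.
Next Obligation. by move=> x y [-> ->]. Qed.

Program Definition rel_vcomp a b c (R : rel_mor b c) (S : rel_mor a b) : rel_mor a c :=
  exist _ (fun x z => exists y, sval S x y /\ sval R y z) _.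
Next Obligation.
by move=> a b c R S x z [y [/(svalP S)[? _] /(svalP R)[_ ?]]].
Qed.

Program Definition rel_hcomp a b a' b' (R : rel_mor a b) (S : rel_mor a' b') :
    rel_mor (a ++ a') (b ++ b') :=
  exist _ (fun x y => exists x1 x2 y1 y2,
    [/\ x = x1 ++ x2, y = y1 ++ y2, sval R x1 y1 & sval S x2 y2]) _.
Next Obligation.
move=> a b a' b' R S x y [x1 [x2 [y1 [y2 [-> ->]]]]].
move=> /(svalP R)[e1 e2] /(svalP S)[e3 e4].
by rewrite !map_cat e1 e2 e3 e4.
Qed.

Program Definition rel_lact n (a : n.-tuple C) b (R : rel_mor a b) (s : 'S_n) :
    rel_mor (permt a s) b :=
  exist _ (fun x y => exists2 t : n.-tuple V, x = permt t s & sval R t y) _.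
Next Obligation.
by move=> n a b R s x y [t -> /(svalP R)[e ->]]; rewrite (map_permt s e).
Qed.

Program Definition rel_ract m a (b : m.-tuple C) (R : rel_mor a b) (s : 'S_m) :
    rel_mor a (permt b s^-1%g) :=
  exist _ (fun x y => exists2 t : m.-tuple V, y = permt t s^-1%g & sval R x t) _.
Next Obligation.
by move=> m a b R s x y [t -> /(svalP R)[-> e]]; rewrite (map_permt _ e).
Qed.

Definition rel_data : prop_data C :=
  PropData rel_id rel_id0 rel_vcomp rel_hcomp rel_lact rel_ract.

Lemma rel_midl (a : seq C) x y :
  sval (midl rel_data a) x y <-> x = y /\ map ty x = a.
Proof.
elim: a x y => [|c a IH] x y /=.
  by split=> [[-> ->] //|[<-]]; case: x.
split=> [[x1 [x2 [y1 [y2 [-> -> [<- s1]]]]]]|].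
  by case/IH => -> s2; rewrite map_cat s1 s2.
case=> <-; case: x => // v x [sv sx].
by exists [:: v], x, [:: v], x; split=> //=; [rewrite sv | apply/IH].
Qed.

Lemma rel_lact_tuple n (a : n.-tuple C) b (R : rel_mor a b) (s : 'S_n)
    (t : n.-tuple V) y :
  sval (rel_lact R s) (permt t s) y <-> sval R t y.
Proof. by split=> [[t' /permt_bij <-]|h] //; exists t. Qed.

(** Colours fix the lengths of related lists. Hence related lists may be replaced by tuples, on
    which permutations act, and a concatenation splits in only one way. *)
Lemma rel_axioms : prop_axioms rel_data.
Proof.
split.
- move=> a b c d f g h; apply: rel_mor_ext => x y /=; split.
    by move=> [z [[w [? ?]] ?]]; exists w; split=> //; exists z.
  by move=> [z [? [w [? ?]]]]; exists w; split=> //; exists z.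
- move=> a b a' b' a'' b'' f g h; apply: rel_mor_ext => x y.
  rewrite sval_mcast /=; split.
    move=> [? [x3 [? [y3 [-> -> [x1 [x2 [y1 [y2 [-> -> ? ?]]]]] ?]]]]].
    exists x1, (x2 ++ x3), y1, (y2 ++ y3); rewrite !catA; split=> //.
    by exists x2, x3, y2, y3.
  move=> [x1 [? [y1 [? [-> -> ? [x2 [x3 [y2 [y3 [-> -> ? ?]]]]]]]]]].
  exists (x1 ++ x2), x3, (y1 ++ y2), y3; rewrite !catA; split=> //.
  by exists x1, x2, y1, y2.
- move=> a b f; apply: rel_mor_ext => x y /=; split.
    by move=> [? [x2 [? [y2 [-> -> [-> ->]]]]]].
  by exists [::], x, [::], y.
- move=> a b f; apply: rel_mor_ext => x y; rewrite sval_mcast /=; split.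
    by move=> [x1 [? [y1 [? [-> -> ? [-> ->]]]]]]; rewrite !cats0.
  by exists x, [::], y, [::]; rewrite !cats0.
- move=> a b f; apply: rel_mor_ext => x y /=; split.
    by move=> [z [? /rel_midl[<-]]].
  move=> h; exists y; split=> //; apply/rel_midl.
  by have [] := svalP f _ _ h.
- move=> a b f; apply: rel_mor_ext => x y /=; split.
    by move=> [z [/rel_midl[->]]].
  move=> h; exists x; split=> //; apply/rel_midl.
  by have [] := svalP f _ _ h.
- move=> a b c a' b' c' f g f' g'; apply: rel_mor_ext => x y /=; split.
    move=> [x1 [x2 [z1 [z2 [-> -> [y1 [? ?]] [y2 [? ?]]]]]]].
    exists (y1 ++ y2); split; first by exists x1, x2, y1, y2.
    by exists y1, y2, z1, z2.
  move=> [? [[x1 [x2 [y1 [y2 [-> -> h1 h2]]]]]]].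
  move=> [y1' [y2' [z1 [z2 [ey -> h3 h4]]]]]; exists x1, x2, z1, z2.
  (* The two splittings of the intermediate list agree because both first parts have the length of
     [b]. *)
  have [e1 e2] : y1 = y1' /\ y2 = y2'.
    apply: cat_eq ey; have [_ ->] := rel_size h1.
    by have [-> _] := rel_size h3.
  by subst y1' y2'; split=> //; [exists y1|exists y2].
- move=> n a b c s f g; apply: rel_mor_ext => x z; split.
    move=> [y []]; rewrite sval_mcast /= => -[t -> h1 h2].
    exists t; split=> //; exists (permt t s^-1%g) => //.
    by rewrite permtVK.
  move=> [? [h1 [t et h2]]]; exists t; split=> //.
  rewrite sval_mcast /=; exists (permt t s); first by rewrite permtK.
  by rewrite -et.
- move=> n a b c f g s; apply: rel_mor_ext => x z /=; split.
    by move=> [t -> [y [? ?]]]; exists y; split=> //; exists t.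
  by move=> [y [[t -> ?] ?]]; exists t => //; exists y.
- move=> m a b c f g s; apply: rel_mor_ext => x z /=; split.
    by move=> [t -> [y [? ?]]]; exists y; split=> //; exists t.
  by move=> [y [? [t -> ?]]]; exists t => //; exists y.
- move=> n p a a' b b' f g s t; apply: rel_mor_ext => x y.
  rewrite sval_mcast /=; split.
    move=> [? [? [y1 [y2 [-> -> [t1 -> h1] [t2 -> h2]]]]]].
    exists (cat_tuple t1 t2); first by rewrite -permt_cat.
    by exists t1, t2, y1, y2.
  move=> [w -> [x1 [x2 [y1 [y2 [ew -> h1 h2]]]]]].
  have [t1 e1] := as_tuple (etrans (proj1 (rel_size h1)) (size_tuple a)).
  have [t2 e2] := as_tuple (etrans (proj1 (rel_size h2)) (size_tuple a')).
  subst x1 x2; have -> : w = cat_tuple t1 t2 by exact: val_inj.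
  exists (permt t1 s), (permt t2 t), y1, y2; split=> //.
  - by rewrite permt_cat.
  - by exists t1.
  - by exists t2.
- move=> m q a a' b b' f g s t; apply: rel_mor_ext => x y.
  rewrite sval_mcast /=; split.
    move=> [x1 [x2 [? [? [-> -> [t1 -> h1] [t2 -> h2]]]]]].
    exists (cat_tuple t1 t2); first by rewrite -permt_catV.
    by exists x1, x2, t1, t2.
  move=> [w -> [x1 [x2 [y1 [y2 [-> ew h1 h2]]]]]].
  have [t1 e1] := as_tuple (etrans (proj2 (rel_size h1)) (size_tuple b)).
  have [t2 e2] := as_tuple (etrans (proj2 (rel_size h2)) (size_tuple b')).
  subst y1 y2; have -> : w = cat_tuple t1 t2 by exact: val_inj.
  exists x1, x2, (permt t1 s^-1%g), (permt t2 t^-1%g); split=> //.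
  - by rewrite permt_catV.
  - by exists t1.
  - by exists t2.
- move=> n m p q a b a' b' f g; apply: rel_mor_ext => x y.
  rewrite sval_mcast /=; split.
    move=> [u -> [v -> [x1 [x2 [y1 [y2 [eu ev h1 h2]]]]]]].
    have [s1 s2] := rel_size h1; have [s3 s4] := rel_size h2.
    have [t1 e1] := as_tuple (etrans s1 (size_tuple a)).
    have [t2 e2] := as_tuple (etrans s2 (size_tuple b)).
    have [t3 e3] := as_tuple (etrans s3 (size_tuple a')).
    have [t4 e4] := as_tuple (etrans s4 (size_tuple b')).
    subst x1 x2 y1 y2; have -> : u = cat_tuple t1 t3 by exact: val_inj.
    have -> : v = cat_tuple t2 t4 by exact: val_inj.
    by rewrite permt_bswap permt_bswapV; exists t3, t1, t4, t2.
  move=> [x2 [x1 [y2 [y1 [-> -> h2 h1]]]]].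
  have [s1 s2] := rel_size h1; have [s3 s4] := rel_size h2.
  have [t1 e1] := as_tuple (etrans s1 (size_tuple a)).
  have [t2 e2] := as_tuple (etrans s2 (size_tuple b)).
  have [t3 e3] := as_tuple (etrans s3 (size_tuple a')).
  have [t4 e4] := as_tuple (etrans s4 (size_tuple b')).
  subst x1 x2 y1 y2; exists (cat_tuple t1 t3); first by rewrite permt_bswap.
  exists (cat_tuple t2 t4); first by rewrite permt_bswapV.
  by exists t1, t3, t2, t4.
- move=> n m a b f s t; apply: rel_mor_ext => x y /=; split.
    by move=> [u -> [v -> ?]]; exists v => //; exists u.
  by move=> [v -> [u -> ?]]; exists u => //; exists v.
- move=> n a b f s t; apply: rel_mor_ext => x y; rewrite sval_mcast /=; split.
    move=> [u -> [v e ?]]; exists v => //.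
    by rewrite -permt_mul -(val_inj (e : val u = val (permt v t))).
  move=> [u -> h]; exists (permt u t); first by rewrite permt_mul.
  by exists u.
- move=> m a b f s t; apply: rel_mor_ext => x y; rewrite sval_mcast /=; split.
    move=> [u -> [v e ?]]; exists v => //.
    by rewrite permt_mulV -(val_inj (e : val u = val (permt v t^-1%g))).
  move=> [u -> h]; exists (permt u t^-1%g); first by rewrite permt_mulV.
  by exists u.
- move=> n a b f; apply: rel_mor_ext => x y; rewrite sval_mcast /=; split.
    by move=> [t ->]; rewrite permt_id.
  move=> h; have [t et] := as_tuple (etrans (proj1 (rel_size h)) (size_tuple a)).
  by subst x; exists t; rewrite ?permt_id.
- move=> m a b f; apply: rel_mor_ext => x y; rewrite sval_mcast /=; split.
    by move=> [t ->]; rewrite -permt_idV.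
  move=> h; have [t et] := as_tuple (etrans (proj2 (rel_size h)) (size_tuple b)).
  by subst y; exists t; rewrite -?permt_idV.
Qed.

Definition rel_prop : prop := MkProp (PropOn rel_axioms).

End RelationProp.

(** * Relabelings in a prop *)

Definition tot (T : prop) : Type := {p : seq (pcol T) * seq (pcol T) & T p.1 p.2}.

(** On the total space horizontal composition is associative without casts, so composites of
    operations of varying arities can be treated as a fold over a list. *)
Definition hcat (T : prop) : seq (tot T) -> tot T :=
  foldr (fun x y : tot T => mtot (mhcomp (tagged x) (tagged y))) (mtot (mid0 T)).

Section Relabel.

Variable (T : prop).
Implicit Types (X Y : Type).
Let ax := pon_axioms (pon T).

Lemma relab_map X Y X' Y' (h : X -> X') (k : Y -> Y') (x y : tot T) L B L' B' :
  relab x L B y L' B' ->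
  relab x (map h L) (map k B) y (map h L') (map k B').
Proof.
case=> [n [m [a [b [f [la [lb [s [t [-> -> [-> ->] [-> ->]]]]]]]]]]].
exists n, m, a, b, f, (map_tuple h la), (map_tuple k lb), s, t.
by split=> //; split; rewrite -permt_map.
Qed.

(** Distinct labels determine both permutations. This turns bookkeeping with labels into equalities
    of operations. *)
Lemma relab_unique (X Y : eqType) (x y y' : tot T) (L L' : seq X) (B B' : seq Y) :
  uniq L -> uniq B -> relab x L B y L' B' -> relab x L B y' L' B' -> y = y'.
Proof.
move=> uL uB [n [m [a [b [f [la [lb [s [t [ex -> [eL eB] [eL' eB']]]]]]]]]]].
subst x L B L' B' => h.
rewrite (relab_fun uL uB (t := t^-1%g) h).
by move: (t^-1^-1)%g (invgK t) => ? ->.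
Qed.

Lemma relab_lact X Y n (a : n.-tuple (pcol T)) m (b : m.-tuple (pcol T)) (f : T a b)
    (la : n.-tuple X) (lb : m.-tuple Y) (s : 'S_n) :
  relab (mtot f) la lb (mtot (mlact f s)) (permt la s) lb.
Proof.
exists n, m, a, b, f, la, lb, s, 1%g; split=> //; last by rewrite -permt_idV.
by apply: mtot_lact; rewrite (mract1 ax) mtot_cast.
Qed.

Lemma relab_ract X Y n (a : n.-tuple (pcol T)) m (b : m.-tuple (pcol T)) (f : T a b)
    (la : n.-tuple X) (lb : m.-tuple Y) (s : 'S_m) :
  relab (mtot f) la lb (mtot (mract f s)) la (permt lb s^-1%g).
Proof.
exists n, m, a, b, f, la, lb, 1%g, s; split=> //; last by rewrite permt_id.
by rewrite (mlact1 ax) mtot_cast.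
Qed.

(* The inner labels [M] determine the permutation by which [f] and [g] are
   both acted on; it cancels in the composite. *)
Lemma relab_vcomp X Y (Z : eqType) a b c a' b' c' (f : T b c) (g : T a b)
    (f' : T b' c') (g' : T a' b') (L L' : seq X) (B B' : seq Y) (M M' : seq Z) :
  uniq M ->
  relab (mtot f) M B (mtot f') M' B' -> relab (mtot g) L M (mtot g') L' M' ->
  relab (mtot (mvcomp f g)) L B (mtot (mvcomp f' g')) L' B'.
Proof.
move=> uM [m [p [b1 [c1 [f1 [lb [lc [s [t [ef ef' [eM ->] [eM' ->]]]]]]]]]]].
case=> [n [m' [a1 [b2 [g1 [la [lb' [s' [t' [eg eg' [-> eM1] [-> eM1']]]]]]]]]]].
have em : m' = m by rewrite -(size_tuple lb') -eM1 eM size_tuple.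
subst m' M; have {eM1} elb := val_inj eM1; subst lb'.
have st : s = t'^-1%g.
  by apply: (permt_inj uM); apply: val_inj; rewrite /= -eM' eM1'.
have [ec1 [ec2 _]] := mtotP (esym ef); have [eb1 [eb2 _]] := mtotP (esym eg).
subst b c a; have eb := val_inj eb2; subst b2.
exists n, p, a1, c1, (mvcomp f1 g1), la, lc, s', t.
split=> //; first exact: mtot_vcomp.
subst s.
rewrite (mtot_vcomp ef' eg') -(mvcomp_act ax) (mract_vcomp ax) (mlact_vcomp ax).
apply: mtot_vcomp => //; rewrite mtot_cast -(mlact_ract ax).
by apply: mtot_lact; rewrite (mractM ax) mtot_cast mulgV (mract1 ax) mtot_cast.
Qed.

Lemma mtot_mhcatE n (a b : 'I_n -> seq (pcol T)) (f : forall i, T (a i) (b i)) :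
  mtot (mhcat f) = hcat (lst (fun i => mtot (f i) : tot T)).
Proof. exact: mhcatE. Qed.

Lemma relab_hcat (I : Type) (x y : I -> tot T) X Y (L L' : I -> seq X)
    (B B' : I -> seq Y) (r : seq I) :
  (forall i, relab (x i) (L i) (B i) (y i) (L' i) (B' i)) ->
  relab (hcat [seq x i | i <- r]) (flatten [seq L i | i <- r])
    (flatten [seq B i | i <- r])
    (hcat [seq y i | i <- r]) (flatten [seq L' i | i <- r])
    (flatten [seq B' i | i <- r]).
Proof.
move=> h; elim: r => [|i r IH] /=; last exact: (relab_hc (h i) IH).
exact: (relab_refl (a := [tuple]) (b := [tuple]) (mid0 T) [tuple] [tuple]).
Qed.

Lemma relab_mhcat n (a : 'I_n -> seq (pcol T)) (b : 'I_n -> seq (pcol T))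
    (f : forall i, T (a i) (b i)) (a' : 'I_n -> seq (pcol T))
    (b' : 'I_n -> seq (pcol T)) (f' : forall i, T (a' i) (b' i))
    X Y (L L' : 'I_n -> seq X) (B B' : 'I_n -> seq Y) :
  (forall i, relab (mtot (f i)) (L i) (B i) (mtot (f' i)) (L' i) (B' i)) ->
  relab (mtot (mhcat f)) (lcat L) (lcat B) (mtot (mhcat f')) (lcat L') (lcat B').
Proof. by move=> h; rewrite !mtot_mhcatE !lstE !lcatE; apply: relab_hcat. Qed.

End Relabel.

(** * Evaluation of pairs, uniformly in the prop *)

Lemma permt_fibers n m (theta : 'I_n -> 'I_m) :
  permt (fibers_tuple theta) (unshuffle theta) = ord_tuple n.
Proof.
apply: val_inj; rewrite -[RHS](permt_unshuffle theta); congr (val (permt _ _)).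
apply: val_inj; rewrite /= -[LHS]map_id.
by apply: eq_map => i; rewrite tnth_ord_tuple.
Qed.

(** When the inputs of the horizontal composite are labelled by the concatenated fibers, sorting the
    labels is exactly the action of [unshuffle]. The closure lemmas use evaluation only through this
    relation. *)
Lemma free_op_eval_relab (O : operad) (P : prop)
    (eta : operad_hom O (forget_data P)) n m (a : n.-tuple (ocol O))
    (b : m.-tuple (ocol O)) (x : free_op a b) :
  relab (mtot (mhcat (fun j => ohop eta (tagged x j) : P _ [:: eta (tnth b j)])))
    (fibers (tag x)) (enum 'I_m) (mtot (free_op_eval eta x)) (enum 'I_n) (enum 'I_m).
Proof.
have ax := pon_axioms (pon P).
set g := mhcat _.
have := relab_lact (a := map_tuple (tnth (map_tuple eta a)) (fibers_tuple (tag x)))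
   (b := lst_tuple (fun j => eta (tnth b j)))
  (mcast (lcat_fiber eta (tag x) a) erefl g) (fibers_tuple (tag x)) (ord_tuple m)
  (unshuffle (tag x)).
rewrite mtot_cast /free_op_eval mtot_cast.
by rewrite permt_fibers.
Qed.

(** If the blocks differed, [x] would be counted at least twice in a list where it occurs at most
    once. *)
Lemma lcat_mem_uniq (X : eqType) m (L : 'I_m -> seq X) x j j' :
  uniq (lcat L) -> x \in L j -> x \in L j' -> j = j'.
Proof.
move=> uL xj xj'; apply/eqP/negPn/negP => neq.
have := leq_b1 (x \in lcat L); rewrite -(count_uniq_mem x uL).
rewrite lcatE count_flatten -map_comp sumnE big_map.
rewrite big_enum /= (bigD1 j) //= (bigD1 j') /=; last by rewrite eq_sym.
move: xj xj'; rewrite -!has_pred1 !has_count.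
by lia.
Qed.

Lemma mem_lcat (X : eqType) m (L : 'I_m -> seq X) x :
  reflect (exists j, x \in L j) (x \in lcat L).
Proof.
rewrite lcatE; apply: (iffP flatten_mapP) => [[j _ ?]|[j ?]]; exists j => //.
by rewrite mem_enum.
Qed.

Lemma uniq_lcat_block (X : eqType) m (L : 'I_m -> seq X) j : uniq (lcat L) -> uniq (L j).
Proof.
have : j \in enum 'I_m by rewrite mem_enum.
rewrite lcatE; case/splitPr => s1 s2; rewrite map_cat flatten_cat /=.
by rewrite !cat_uniq => /and3P[_ _ /and3P[]].
Qed.

Lemma perm_eq_permt (Y : eqType) (L L' : seq Y) : perm_eq L L' ->
  exists s : 'S_(size L), L' = permt (in_tuple L) s.
Proof.
rewrite perm_sym => pL; have /tuple_permP[s e] : perm_eq L' (in_tuple L) by [].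
by exists s.
Qed.

Lemma uniq_fiber n m (theta : 'I_n -> 'I_m) j : uniq (fiber theta j).
Proof. exact/filter_uniq/enum_uniq. Qed.

Lemma mem_fiber n m (theta : 'I_n -> 'I_m) i j : (i \in fiber theta j) = (theta i == j).
Proof. by rewrite mem_filter mem_enum andbT. Qed.

Lemma mtot_ohop (O : operad) (P : prop) (eta : operad_hom O (forget_data P))
    a a' c (f : O a c) (f' : O a' c) : otot f = otot f' ->
  mtot (ohop eta f : P _ [:: eta c]) = mtot (ohop eta f' : P _ [:: eta c]).
Proof. by move=> e; have [ea ->] := ototP e; case: _ / ea. Qed.

(* The blocks [L j] need not be increasing: sorting them acts on the [f j]. *)
Lemma free_op_of_blocks (O : operad) n m (a : n.-tuple (ocol O))
    (b : m.-tuple (ocol O)) (L : 'I_m -> seq 'I_n)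
    (f : forall j, O (map (tnth a) (L j)) (tnth b j)) :
  perm_eq (lcat L) (enum 'I_n) ->
  exists z : free_op a b, forall (P : prop) (eta : operad_hom O (forget_data P)),
    relab (mtot (mhcat (fun j => ohop eta (f j) : P _ [:: eta (tnth b j)])))
      (lcat L) (enum 'I_m) (mtot (free_op_eval eta z)) (enum 'I_n) (enum 'I_m).
Proof.
move=> pL; have uL : uniq (lcat L) by rewrite (perm_uniq pL) enum_uniq.
have exj i : exists j, i \in L j.
  by apply/mem_lcat; rewrite (perm_mem pL) mem_enum.
pose theta := [ffun i => xchoose (exj i)].
have pj j : perm_eq (L j) (fiber theta j).
  apply: uniq_perm; rewrite ?uniq_fiber ?(uniq_lcat_block j uL) // => i.
  rewrite mem_fiber ffunE; have h := xchooseP (exj i).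
  apply/idP/eqP => [ij|<- //]; exact: lcat_mem_uniq uL h ij.
have exf j : exists f' : O (map (tnth a) (fiber theta j)) (tnth b j),
    exists2 s : 'S_(size (L j)), fiber theta j = permt (in_tuple (L j)) s &
    otot f' = otot (oact (a := map_tuple (tnth a) (in_tuple (L j))) (f j) s).
  have [s e] := perm_eq_permt (pj j).
  have e' : permt (map_tuple (tnth a) (in_tuple (L j))) s =
      map (tnth a) (fiber theta j) :> seq _ by rewrite permt_map e.
  exists (ocast e' (oact (a := map_tuple (tnth a) (in_tuple (L j))) (f j) s)).
  by exists s; rewrite ?otot_cast.
(* The pair is fixed before [P] and [eta] are introduced, so that it serves all props at once. *)
pose z : free_op a b := existT _ theta (fun j => projT1 (cid (exf j))).
exists z => P eta; apply: relab_trans (free_op_eval_relab eta z).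
have lst1 : lcat (fun j => [:: j]) = enum 'I_m.
  by rewrite -[LHS]/(lst id) lstE map_id.
rewrite -lst1; apply: relab_mhcat => j /=.
case: (cid (exf j)) => f' [s e ef'].
have := relab_lact (a := map_tuple eta (map_tuple (tnth a) (in_tuple (L j))))
  (b := [tuple eta (tnth b j)]) (ohop eta (f j)) (in_tuple (L j)) [tuple j] s.
suff -> : mtot (ohop eta f' : P _ [:: eta (tnth b j)]) = mtot (mlact
    (a := map_tuple eta (map_tuple (tnth a) (in_tuple (L j))))
    (ohop eta (f j) : P _ [:: eta (tnth b j)]) s).
  by rewrite -e.
rewrite (mtot_ohop eta ef') (ohop_act eta (a := map_tuple (tnth a) (in_tuple (L j)))).
by rewrite mtot_ocast.
Qed.

Lemma dep_choice I (T : I -> Type) (R : forall i, T i -> Prop) :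
  (forall i, exists t, R i t) -> exists f : forall i, T i, forall i, R i (f i).
Proof. by move=> h; exists (fun i => projT1 (cid (h i))) => i; case: cid. Qed.

(** * Closure of evaluated pairs under the operations of a prop *)

Section Closure.

Variable O : operad.
Local Notation C := (ocol O).
Local Notation ev := free_op_eval.

(** The common form of the closure arguments: it suffices to obtain [y] by sorting labels from a
    horizontal composite of images of operations of [O], since the labels are distinct and leave no
    freedom. Taking [y] as a family over all props keeps the pair independent of [P]. *)
Lemma free_op_of_blocks_eq n m (a : n.-tuple C) (b : m.-tuple C) (L : 'I_m -> seq 'I_n)
    (f : forall j, O (map (tnth a) (L j)) (tnth b j))
    (y : forall P : prop, operad_hom O (forget_data P) -> tot P) :
  perm_eq (lcat L) (enum 'I_n) ->
  (forall (P : prop) (eta : operad_hom O (forget_data P)),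
    relab (mtot (mhcat (fun j => ohop eta (f j) : P _ [:: eta (tnth b j)])))
      (lcat L) (enum 'I_m) (y P eta) (enum 'I_n) (enum 'I_m)) ->
  exists z : free_op a b, forall P eta, mtot (ev (P := P) eta z) = y P eta.
Proof.
move=> pL hy; have [z hz] := free_op_of_blocks f pL; exists z => P eta.
apply: relab_unique (hz P eta) (hy P eta); last exact: enum_uniq.
by rewrite (perm_uniq pL) enum_uniq.
Qed.

Lemma free_op_unit n (a : n.-tuple C) c (f : O a c) :
  exists z : free_op a [tuple c], forall (P : prop) (eta : operad_hom O (forget_data P)),
    mtot (ev eta z) = mtot (ohop eta f : P _ [:: eta c]).
Proof.
(* The block prescribes the type of the operation. Stating existence together with the value under
   [eta] allows the type to be rewritten in the goal; [dep_choice] then collects the family. The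
   lemmas below use the same device. *)
have exf j : exists g : O (map (tnth a) (enum 'I_n)) (tnth [tuple c] j),
    forall (P : prop) (eta : operad_hom O (forget_data P)),
      mtot (ohop eta g : P _ [:: _]) = mtot (ohop eta f : P _ [:: eta c]).
  by rewrite map_tnth_enum ord1; exists f.
have [g hg] := dep_choice exf.
apply: (free_op_of_blocks_eq (L := fun=> enum 'I_n) (f := g)) => [|P eta].
  by rewrite /= cats0.
rewrite /= (mhcompf0 (pon_axioms (pon P))) mtot_cast hg cats0.
exact: (relab_refl (a := map_tuple eta a) (b := [tuple eta c]) _ (ord_tuple n) (ord_tuple 1)).
Qed.

Lemma free_op_id0 : exists z : free_op [tuple of [::] : seq C] [tuple of [::] : seq C],
  forall (P : prop) (eta : operad_hom O (forget_data P)),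
    mtot (ev eta z) = mtot (mid0 P).
Proof.
have [f _] := @dep_choice 'I_0 (fun j => O (map (tnth [tuple]) [::]) (tnth [tuple] j))
  (fun _ _ => True) ltac:(by case).
apply: (free_op_of_blocks_eq (L := fun=> [::]) (f := f)) => [|P eta] //=.
  by rewrite enum_ord0.
rewrite enum_ord0.
exact: (relab_refl (a := [tuple]) (b := [tuple]) (mid0 P) [tuple] [tuple]).
Qed.

Lemma free_op_lact n (a : n.-tuple C) m (b : m.-tuple C) (x : free_op a b) (s : 'S_n) :
  exists z : free_op (permt a s) b,
  forall (P : prop) (eta : operad_hom O (forget_data P)),
    mtot (ev eta z) = mtot (mlact (a := map_tuple eta a) (ev eta x) s).
Proof.
(* Position [i] of [permt a s] holds input [s i], so input [i] of [x] is found at position [s^-1 i].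
   The resulting blocks need not be increasing. *)
pose L j := map s^-1%g (fiber (tag x) j).
have exf j : exists f : O (map (tnth (permt a s)) (L j)) (tnth b j),
    forall (P : prop) (eta : operad_hom O (forget_data P)),
    mtot (ohop eta f : P _ [:: _]) = mtot (ohop eta (tagged x j) : P _ [:: _]).
  have -> : map (tnth (permt a s)) (L j) = map (tnth a) (fiber (tag x) j).
    by rewrite -map_comp; apply: eq_map => i; rewrite /= tnth_mktuple permKV.
  by exists (tagged x j).
have [f hf] := dep_choice exf.
have eL : lcat L = map s^-1%g (fibers (tag x)) by rewrite -map_lcat.
apply: (free_op_of_blocks_eq (f := f)) => [|P eta].
  rewrite eL; apply: uniq_perm; rewrite ?enum_uniq //.
    rewrite (map_inj_uniq perm_inj) (perm_uniq (perm_fibers _)) enum_uniq //.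
  move=> i; rewrite mem_enum; apply/mapP; exists (s i); last by rewrite permK.
  by rewrite (perm_mem (perm_fibers _)) mem_enum.
rewrite (mtot_mhcat (fun j => hf j P eta)) eL.
have h := relab_map (s^-1)%g id (free_op_eval_relab eta x).
rewrite !map_id in h; apply: relab_trans h _.
have := relab_lact (a := map_tuple eta a) (b := map_tuple eta b) (ev eta x)
   (map_tuple (s^-1)%g (ord_tuple n)) (ord_tuple m) s.
have -> // : permt (map_tuple (s^-1)%g (ord_tuple n)) s = enum 'I_n :> seq _.
rewrite -[RHS]/(val (ord_tuple n)); congr val; apply: eq_from_tnth => i.
by rewrite tnth_mktuple tnth_map !tnth_ord_tuple permK.
Qed.

(** Permuting the outputs permutes the factors of the horizontal composite together with their input
    blocks; [relab_perm] restores the order of the factors. *)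
Lemma free_op_ract n (a : n.-tuple C) m (b : m.-tuple C) (x : free_op a b) (t : 'S_m) :
  exists z : free_op a (permt b t^-1%g),
  forall (P : prop) (eta : operad_hom O (forget_data P)),
    mtot (ev eta z) = mtot (mract (b := map_tuple eta b) (ev eta x) t).
Proof.
pose L j := fiber (tag x) (t^-1%g j).
have exf j : exists f : O (map (tnth a) (L j)) (tnth (permt b t^-1%g) j),
    forall (P : prop) (eta : operad_hom O (forget_data P)),
    mtot (ohop eta f : P _ [:: _]) = mtot (ohop eta (tagged x (t^-1%g j)) : P _ [:: _]).
  by rewrite tnth_mktuple; exists (tagged x (t^-1%g j)).
have [f hf] := dep_choice exf.
have pt : perm_eq (map (t^-1)%g (enum 'I_m)) (enum 'I_m).
  apply: uniq_perm; rewrite ?(map_inj_uniq perm_inj) ?enum_uniq //.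
  move=> i; rewrite mem_enum; apply/mapP; exists (t i); first by rewrite mem_enum.
  by rewrite permK.
pose X (P : prop) (eta : operad_hom O (forget_data P)) j : tot P :=
  mtot (ohop eta (tagged x j) : P _ [:: eta (tnth b j)]).
have eL : lcat L = flatten [seq fiber (tag x) j | j <- map (t^-1)%g (enum 'I_m)].
  by rewrite lcatE (map_comp (fiber (tag x)) (t^-1)%g).
apply: (free_op_of_blocks_eq (f := f)) => [|P eta].
  rewrite eL; apply: perm_trans (perm_fibers (tag x)); rewrite /fibers lcatE.
  exact/perm_flatten/perm_map.
rewrite mtot_mhcatE lstE (eq_map (fun j => hf j P eta)) eL.
rewrite (map_comp (X P eta) (t^-1)%g).
have fl r : flatten [seq [:: t j] | j <- r] = map t r.
  by rewrite (map_comp (fun j => [:: j]) t) flatten_seq1.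
have sizeX i : size (fiber (tag x) i) = size (tag (X P eta i)).1 by rewrite !size_map.
(* With output [j] of [x] labelled [t j], the factors listed along [t^-1] carry the output labels in
   increasing order. *)
have h := @relab_perm P _ (X P eta) _ _ _ (fun j => [:: t j]) sizeX (fun=> erefl)
  _ _ (perm_Permutation pt).
rewrite !fl (mapK (permKV t)) in h; apply: relab_trans h _.
have h' := relab_map id t (free_op_eval_relab eta x).
rewrite !map_id mtot_mhcatE lstE /fibers lcatE in h'; apply: relab_trans h' _.
have := relab_ract (a := map_tuple eta a) (b := map_tuple eta b) (ev eta x)
   (ord_tuple n) (map_tuple t (ord_tuple m)) t.
have -> // : permt (map_tuple t (ord_tuple m)) t^-1%g = enum 'I_m :> seq _.
rewrite -[RHS]/(val (ord_tuple m)); congr val; apply: eq_from_tnth => i.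
by rewrite tnth_mktuple tnth_map !tnth_ord_tuple permKV.
Qed.

Lemma enum_add m n : enum 'I_(m + n) =
  map (@lshift m n) (enum 'I_m) ++ map (@rshift m n) (enum 'I_n).
Proof.
apply: (inj_map val_inj); rewrite val_enum_ord iotaD map_cat.
rewrite -(map_comp val (@lshift m n)) -(map_comp val (@rshift m n)).
rewrite -[X in _ ++ iota X _]addn0 iotaDl -!val_enum_ord.
by rewrite -(map_comp (addn _) val).
Qed.

Lemma free_op_hcomp n (a : n.-tuple C) m (b : m.-tuple C) p (a' : p.-tuple C)
    q (b' : q.-tuple C) (x : free_op a b) (x' : free_op a' b') :
  exists z : free_op (cat_tuple a a') (cat_tuple b b'),
  forall (P : prop) (eta : operad_hom O (forget_data P)),
    mtot (ev eta z) = mtot (mhcomp (ev eta x) (ev eta x')).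
Proof.
have splitl k : split (lshift q k) = inl k :> 'I_m + 'I_q := unsplitK (inl k).
have splitr k : split (rshift m k) = inr k :> 'I_m + 'I_q := unsplitK (inr k).
(* Blocks and operations are indexed by the disjoint union of the two output sets and pulled back
   along [split], which avoids casts between ordinals. *)
pose LL (u : 'I_m + 'I_q) : seq 'I_(n + p) := match u with
  | inl j => map (@lshift n p) (fiber (tag x) j)
  | inr j => map (@rshift n p) (fiber (tag x') j) end.
pose X (P : prop) (eta : operad_hom O (forget_data P)) (u : 'I_m + 'I_q) : tot P :=
  match u with
  | inl j => mtot (ohop eta (tagged x j) : P _ [:: eta (tnth b j)])
  | inr j => mtot (ohop eta (tagged x' j) : P _ [:: eta (tnth b' j)]) end.
pose L j := LL (split j).
have exf j : exists f : O (map (tnth (cat_tuple a a')) (L j)) (tnth (cat_tuple b b') j),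
    forall (P : prop) (eta : operad_hom O (forget_data P)),
    mtot (ohop eta f : P _ [:: _]) = X P eta (split j).
  rewrite /L; case: (split_ordP j) => k ->; rewrite ?tnth_lshift ?tnth_rshift.
    rewrite /LL.
    have -> : map (tnth (cat_tuple a a')) (map (@lshift n p) (fiber (tag x) k)) =
        map (tnth a) (fiber (tag x) k).
      by rewrite -map_comp; apply: eq_map => i; rewrite /= tnth_lshift.
    by exists (tagged x k).
  rewrite /LL.
  have -> : map (tnth (cat_tuple a a')) (map (@rshift n p) (fiber (tag x') k)) =
      map (tnth a') (fiber (tag x') k).
    by rewrite -map_comp; apply: eq_map => i; rewrite /= tnth_rshift.
  by exists (tagged x' k).
have [f hf] := dep_choice exf.
have sp X' (g : 'I_m + 'I_q -> X') : map (fun j => g (split j)) (enum 'I_(m + q)) =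
    map (fun j => g (inl j)) (enum 'I_m) ++ map (fun j => g (inr j)) (enum 'I_q).
  rewrite enum_add map_cat -!map_comp; congr (_ ++ _); apply: eq_map => j /=.
    by rewrite splitl.
  by rewrite splitr.
have eL : lcat L = map (@lshift n p) (fibers (tag x)) ++ map (@rshift n p) (fibers (tag x')).
  by rewrite lcatE sp flatten_cat /fibers !map_lcat !lcatE.
apply: (free_op_of_blocks_eq (f := f)) => [|P eta].
  rewrite eL enum_add; apply: perm_cat; apply: perm_map; exact: perm_fibers.
rewrite mtot_mhcatE lstE (eq_map (fun j => hf j P eta)) eL sp.
rewrite !enum_add /hcat H_cat.
have := relab_hc
  (relab_map (@lshift n p) (@lshift m q) (free_op_eval_relab eta x))
  (relab_map (@rshift n p) (@rshift m q) (free_op_eval_relab eta x')).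
by rewrite !mtot_mhcatE !lstE; exact.
Qed.

Lemma flatten_lcat X n (L : 'I_n -> seq (seq X)) :
  flatten (lcat L) = lcat (fun i => flatten (L i)).
Proof. by elim: n L => //= n IH L; rewrite flatten_cat IH. Qed.

Lemma free_op_vcomp n (a : n.-tuple C) m (b : m.-tuple C) p (c : p.-tuple C)
    (x : free_op b c) (y : free_op a b) :
  exists z : free_op a c,
  forall (P : prop) (eta : operad_hom O (forget_data P)),
    mtot (ev eta z) = mtot (mvcomp (ev eta x) (ev eta y)).
Proof.
pose t j := in_tuple (fiber (tag x) j).
have lst_t D (h : 'I_m -> D) j : map h (fiber (tag x) j) = lst (fun i => h (tnth (t j) i)).
  exact: etrans (congr1 (map h) (esym (lst_tnth (t j)))) (map_lst _ _).
(* The inputs reaching output [j], grouped by the intermediate index rather than in increasing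
   order; this is the order of inputs of the operadic composite. *)
pose L j := lcat (fun i => fiber (tag y) (tnth (t j) i)).
have lst_eta (P : prop) (eta : operad_hom O (forget_data P)) j :
    map eta (map (tnth b) (fiber (tag x) j)) =
    lst (fun i => eta (tnth b (tnth (t j) i))) by rewrite -map_comp lst_t.
pose X (P : prop) (eta : operad_hom O (forget_data P)) j :
    P (lcat (fun i => [:: eta (tnth b (tnth (t j) i))])) [:: eta (tnth c j)] :=
  mcast (lst_eta P eta j) erefl (ohop eta (tagged x j)).
pose Y (P : prop) (eta : operad_hom O (forget_data P)) i : P _ [:: eta (tnth b i)] :=
  ohop eta (tagged y i).
have exf j : exists f : O (map (tnth a) (L j)) (tnth c j),
    forall (P : prop) (eta : operad_hom O (forget_data P)),
    mtot (ohop eta f : P _ [:: _]) =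
    mtot (mvcomp (X P eta j) (mhcat (fun i => Y P eta (tnth (t j) i)))).
  exists (ocast (esym (map_lcat _ _)) (ocomp (b := fun i => tnth b (tnth (t j) i))
    (ocast (lst_t _ (tnth b) j) (tagged x j)) (fun i => tagged y (tnth (t j) i)))).
  move=> P eta; rewrite (mtot_ohop eta (otot_cast _ _)) ohop_comp mtot_ocast.
  apply: mtot_vcomp => //; rewrite mtot_ocast mtot_cast.
  exact: mtot_ohop (otot_cast _ _).
have [f hf] := dep_choice exf.
have eL : lcat L = flatten [seq fiber (tag y) i | i <- fibers (tag x)].
  rewrite /fibers map_lcat flatten_lcat; congr lcat; apply: funext => j.
  by rewrite /L lcatE (map_comp (fiber (tag y)) (tnth (t j))) map_tnth_enum.
have pfl : perm_eq (fibers (tag x)) (enum 'I_m) := perm_fibers (tag x).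
apply: (free_op_of_blocks_eq (f := f)) => [|P eta].
  rewrite eL; apply: perm_trans (perm_fibers (tag y)).
  rewrite [fibers (tag y)]lcatE.
  exact/perm_flatten/perm_map.
rewrite (mtot_mhcat (fun j => hf j P eta)) -mvcomp_mhcat.
(* The inner labels are [fibers (tag x)]. Sorting them is [unshuffle] on the inputs of the outer
   factor and a reordering of the horizontal factors on the inner one. *)
apply: (@relab_vcomp _ _ _ _ _ _ _ _ _ _ _ _ _ _ _ _ _ _ (fibers (tag x)) (enum 'I_m)).
- by rewrite (perm_uniq pfl) enum_uniq.
- suff -> : mtot (mhcat (X P eta)) =
    mtot (mhcat (fun j => ohop eta (tagged x j) : P _ [:: eta (tnth c j)])).
    exact: free_op_eval_relab.
  by apply: mtot_mhcat => j; rewrite mtot_cast.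
pose Z i : tot P := mtot (Y P eta i).
have -> : mtot (mhcat (fun j => mhcat (fun i => Y P eta (tnth (t j) i)))) =
    hcat [seq Z i | i <- fibers (tag x)].
  rewrite /fibers map_lcat mtot_mhcatE.
  transitivity (hcat (lcat (fun j => lst (fun i => Z (tnth (t j) i))))).
    apply: etrans (esym (H_lcat _)); congr (hcat (lst _)); apply: funext => j.
    exact: mhcatE.
  by congr (hcat (lcat _)); apply: funext => j; rewrite lst_t.
have sizeZ i : size (fiber (tag y) i) = size (tag (Z i)).1 by rewrite !size_map.
have h := @relab_perm P _ Z _ _ _ (fun i => [:: i]) sizeZ (fun=> erefl)
  _ _ (perm_Permutation pfl).
rewrite !flatten_seq1 -eL in h; apply: relab_trans h _.
have := free_op_eval_relab eta y.
by rewrite mtot_mhcatE lstE /fibers lcatE.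
Qed.

End Closure.

(** * A prop separating the pairs *)

Lemma lst_inj X n : injective (@lst X n).
Proof.
elim: n => [|n IH] f g; first by move=> _; apply: funext => -[].
move=> [e /IH e']; apply: funext => i; case: (unliftP ord0 i) => [j|] -> //.
exact: (congr1 (fun h : 'I_n -> X => h j) e').
Qed.

(** Reindexes a dependent family along a bijection with no cast in the conclusion. Inside, the value
    at [j] is required to match [Q i] for every proof of [s i = j], so that [erefl] can be
    substituted at the end. *)
Lemma bij_section I J (T : J -> Type) (s : I -> J) (Q : forall i, T (s i)) :
  bijective s -> exists W : forall j, T j, forall i, W (s i) = Q i.
Proof.
move=> [r rs sr].
have h j : exists t : T j, forall i (e : s i = j), t = ecast x (T x) e (Q i).
  case: _ / (sr j); exists (Q (r j)) => i e.
  have := can_inj rs e => ei; subst i.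
  by rewrite (Prop_irrelevance e erefl).
have [W hW] := dep_choice h; exists W => i; exact: (hW _ i erefl).
Qed.

(** * The free algebra over an operad and its action by relations *)

Section FreeAlgebra.

Variable O : operad.
Local Notation C := (ocol O).
Let axO := oaxioms O.

(** The output colour is packed as well, since [eqv] compares terms whose colours are not known to
    agree. *)
Definition optot a c (f : O a c) : {p : seq C * C & O p.1 p.2} := existT _ (a, c) f.

Lemma optot_otot a a' c (f : O a c) (f' : O a' c) :
  optot f = optot f' <-> otot f = otot f'.
Proof.
split=> [e|e]; last by have [ea ->] := ototP e; case: _ / ea.
have ea : a = a' by case: (projT1_eq e).
subst a'; have := projT2_eq e; rewrite (Prop_irrelevance (projT1_eq e) erefl) /=.
by move=> ->.
Qed.

Lemma optot_out a a' c c' (f : O a c) (f' : O a' c') : optot f = optot f' -> c = c'.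
Proof. by move=> e; case: (projT1_eq e). Qed.

(* An operation of O applied to variables labelled by natural numbers. *)
Record lop (c : C) := Lop {
  ar : nat; lab : ar.-tuple nat; src : ar.-tuple C; body : O src c }.

(** Identifies [f(x_0, x_1, ...)] with [(s^* f)(x_(s 0), x_(s 1), ...)]. *)
Definition eqv c c' (w : lop c) (w' : lop c') : Prop :=
  exists2 s : 'S_(ar w), lab w' = permt (lab w) s :> seq nat &
    optot (body w') = optot (oact (body w) s).

Lemma eqv_eq c (w w' : lop c) :
  lab w = lab w' :> seq nat -> otot (body w) = otot (body w') -> eqv w w'.
Proof.
move=> el eb; exists 1%g; first by rewrite permt_id el.
by apply/optot_otot; rewrite (oact1 axO) otot_cast.
Qed.

Lemma eqv_refl c (w : lop c) : eqv w w.
Proof. exact: (eqv_eq erefl erefl). Qed.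

Lemma eqv_trans c c' c'' (w : lop c) (w' : lop c') (w'' : lop c'') :
  eqv w w' -> eqv w' w'' -> eqv w w''.
Proof.
case: w w' => n l x h [n' l' x' h'] [/= s el eh] [/= s' el'' eh''].
have en : n' = n by rewrite -(size_tuple l') el size_map size_enum_ord.
have ec := optot_out eh.
subst n' c'; have {}el : l' = permt l s by exact: val_inj.
subst l'; exists (s' * s)%g; first by rewrite el'' -permt_mul.
rewrite eh''; apply/optot_otot.
rewrite (otot_act (f' := oact h s)) ?(oactM axO) ?otot_cast //.
exact/optot_otot.
Qed.

Lemma eqv_sym c c' (w : lop c) (w' : lop c') : eqv w w' -> eqv w' w.
Proof.
case: w w' => n l x h [n' l' x' h'] [/= s el eh].
have en : n' = n by rewrite -(size_tuple l') el size_map size_enum_ord.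
have ec := optot_out eh.
subst n' c'; have {}el : l' = permt l s by exact: val_inj.
subst l'; exists s^-1%g; first by rewrite permtK.
apply/optot_otot.
rewrite (otot_act (f' := oact h s)) ?(oactM axO) ?otot_cast.
  by rewrite mulVg (oact1 axO) otot_cast.
exact/optot_otot.
Qed.

(* The free O-algebra: classes of [lop] modulo permutation of the variables. *)
Definition falg : Type :=
  {K : {c & lop c} -> Prop | exists w, K = fun w' => eqv (tagged w) (tagged w')}.

Definition cls c (w : lop c) : falg :=
  exist _ (fun w' => eqv w (tagged w')) (ex_intro _ (existT _ c w) erefl).

Lemma clsP c c' (w : lop c) (w' : lop c') : cls w = cls w' <-> eqv w w'.
Proof.
split=> [e|e].
  have := congr1 (fun v => sval v (existT _ c' w')) e => /= ->; exact: eqv_refl.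
have ek : (fun w1 => eqv w (tagged w1)) = (fun w1 : {c & lop c} => eqv w' (tagged w1)).
  apply: funext => w1; apply: propext; split=> h; last exact: eqv_trans e h.
  exact: eqv_trans (eqv_sym e) h.
rewrite /cls; move: (ex_intro _ _ _) (ex_intro _ _ _); rewrite ek => p q.
by congr exist; apply: Prop_irrelevance.
Qed.

Lemma falg_cls (v : falg) : exists c (w : lop c), v = cls w.
Proof.
case: v => K h; have [[c w] /= e] := h; exists c, w; subst K.
by congr exist; apply: Prop_irrelevance.
Qed.

(** The representative is chosen, but [eqv] preserves the output colour. *)
Definition fcol (v : falg) : C := tag (projT1 (cid (svalP v))).

Lemma fcol_cls c (w : lop c) : fcol (cls w) = c.
Proof.
rewrite /fcol; case: cid => -[c' w'] /= e.
have [s _ /optot_out //] : eqv w w'.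
by have := congr1 (fun K => K (existT _ c' w')) e => /= ->; exact: eqv_refl.
Qed.

Definition lcomp n (b : 'I_n -> C) c (f : O (lst b) c) (W : forall i, lop (b i)) : lop c :=
  Lop (lcat_tuple (fun i => lab (W i))) (ocomp f (fun i => body (W i)) : O (lcat_tuple _) c).

(** The permutations of the individual arguments assemble to [pdiag s], and equivariance of
    composition in the inner operations moves it outside. *)
Lemma lcomp_eqv n (b : 'I_n -> C) c (f : O (lst b) c) (W W' : forall i, lop (b i)) :
  (forall i, eqv (W i) (W' i)) -> eqv (lcomp f W) (lcomp f W').
Proof.
move=> e; have h i : exists s : 'S_(ar (W i)),
    lab (W' i) = permt (lab (W i)) s :> seq nat /\
    otot (body (W' i)) = otot (oact (body (W i)) s).
  by have [s el /optot_otot eb] := e i; exists s.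
have [s hs] := dep_choice h; exists (pdiag s) => /=.
  by rewrite -permt_pdiag; congr lcat; apply: funext => i; have [] := hs i.
apply/optot_otot; rewrite (otot_comp (g' := f) (f' := fun i => oact (body (W i)) (s i))) //.
  by rewrite (ocomp_actr axO) otot_cast.
by move=> i; have [] := hs i.
Qed.

(** Equivariance in the outer operation: permuting the arguments acts on the concatenated labels by
    the block permutation. *)
Lemma lcomp_perm n (b : 'I_n -> C) c (f : O (lst b) c) (s : 'S_n) (W : forall i, lop (b i)) :
  eqv (lcomp f W)
    (lcomp (ocast (permt_lst b s) (oact (a := lst_tuple b) f s)) (fun i => W (s i))).
Proof.
exists (Defs.pblock (fun i => ar (W i)) s) => /=.
  by rewrite -permt_pblock.
by apply/optot_otot; rewrite (ocomp_actl axO f (fun i => body (W i)) s) otot_cast.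
Qed.

Lemma lcomp_lcomp n (k : 'I_n -> nat) (b : 'I_n -> C) c (a : forall i, 'I_(k i) -> C)
    (g : O (lst b) c) (f : forall i, O (lst (a i)) (b i)) (W : forall i j, lop (a i j)) :
  eqv (lcomp (ocast (lst_sig a) (ocomp g f))
        (fun q => W (tagnat.sig1 q) (tagnat.sig2 q)))
    (lcomp g (fun i => lcomp (f i) (W i))).
Proof.
apply: eqv_eq => /=.
  by rewrite (lcat_sig (fun i j => lab (W i j))).
by rewrite (ocompA axO g f (fun i j => body (W i j))) otot_cast.
Qed.

Lemma lcomp_id c (W : 'I_1 -> lop c) :
  eqv (lcomp (oid O c : O (lst (fun _ : 'I_1 => c)) c) W) (W ord0).
Proof.
apply: eqv_eq => /=; first by rewrite cats0.
rewrite (otot_comp (g' := oid O c : O (lst (fun _ : 'I_1 => c)) c)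
  (f' := fun=> body (W ord0))) //.
  by rewrite (ocomp1f axO) otot_cast.
by move=> i; rewrite ord1.
Qed.

(** The graph of the action of [f]. Arguments form a family over an ordinal while inputs form a
    list, hence the quantified equation [a = lst b]; [map id a] is the shape required of a morphism
    that is the identity on colours. *)
Program Definition falg_op a c (f : O a c) : rel_mor fcol (map id a) [:: c] :=
  exist _ (fun X Y => exists n (b : 'I_n -> C) (e : a = lst b) (W : forall i, lop (b i)),
    X = lst (fun i => cls (W i)) /\ Y = [:: cls (lcomp (ocast e f) W)]) _.
Next Obligation.
move=> a c f X Y [n [b [e [W [-> ->]]]]]; subst a.
rewrite map_id map_lst /= fcol_cls; split=> //.
by congr lst; apply: funext => i; apply: fcol_cls.
Qed.

Lemma falg_op_lst n (b : 'I_n -> C) c (f : O (lst b) c) X Y :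
  sval (falg_op f) X Y <-> exists W : forall i, lop (b i),
    X = lst (fun i => cls (W i)) /\ Y = [:: cls (lcomp f W)].
Proof.
split=> [/= [n' [b' [e [W [-> ->]]]]]|[W [-> ->]]]; last by exists n, b, erefl, W.
have en : n' = n by rewrite -(eqP (size_lst b)) e (eqP (size_lst _)).
subst n'; have eb := lst_inj e; subst b'.
by exists W; rewrite (Prop_irrelevance e erefl).
Qed.

Lemma sval_otot a a' c (f : O a c) (f' : O a' c) :
  otot f = otot f' -> sval (falg_op f) = sval (falg_op f').
Proof. by move=> e; have [ea ->] := ototP e; case: _ / ea. Qed.

Let M := rel_prop fcol.

Lemma sval_mhcat n (a b : 'I_n -> seq C) (R : forall i, M (a i) (b i)) X Y :
  sval (mhcat R) X Y <-> exists (x y : 'I_n -> seq falg),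
    [/\ X = lcat x, Y = lcat y & forall i, sval (R i) (x i) (y i)].
Proof.
elim: n a b R X Y => [|n IH] a b R X Y.
  split=> [[-> ->]|[x [y [-> -> _]]] //].
  by exists (fun=> [::]), (fun=> [::]); split=> // -[].
split=> [[x1 [x2 [y1 [y2 [-> -> h1]]]]]|[x [y [-> -> h]]]].
  case/IH => x [y [-> -> h]].
  (* The family with [z] at [ord0], followed by [z']. *)
  pose F (z : seq falg) (z' : 'I_n -> seq falg) i := oapp z' z (unlift ord0 i).
  exists (F x1 x), (F y1 y); split=> [||i].
  - rewrite /= /F unlift_none; congr (_ ++ lcat _); apply: funext => i.
    by rewrite liftK.
  - rewrite /= /F unlift_none; congr (_ ++ lcat _); apply: funext => i.
    by rewrite liftK.
  - rewrite /F; case: (unliftP ord0 i) => [j|] -> //.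
exists (x ord0), (lcat (fun i => x (lift ord0 i))).
exists (y ord0), (lcat (fun i => y (lift ord0 i))).
split=> //; apply/IH.
by exists (fun i => x (lift ord0 i)), (fun i => y (lift ord0 i)).
Qed.

Lemma sval_ocast a a' c (e : a = a') (f : forget_data M a c) :
  sval (ocast e f : M a' [:: c]) = sval (f : M a [:: c]).
Proof. by case: _ / e. Qed.

Lemma cls_lcomp n (b : 'I_n -> C) c (f : O (lst b) c) (W W' : forall i, lop (b i)) :
  (forall i, cls (W i) = cls (W' i)) -> cls (lcomp f W) = cls (lcomp f W').
Proof. by move=> e; apply/clsP/lcomp_eqv => i; apply/clsP. Qed.

Lemma falg_op_lact n (b : 'I_n -> C) c (f : O (lst b) c) (s : 'S_n) X Y :
  sval (falg_op (oact (a := lst_tuple b) f s)) X Y <->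
  exists2 t : n.-tuple falg, X = permt t s & sval (falg_op f) t Y.
Proof.
rewrite -(sval_otot (otot_cast (permt_lst b s) _)) falg_op_lst; split.
  move=> [W [-> ->]].
  have [U hU] := @bij_section _ _ (fun i => lop (b i)) s W (Bijective (permK s) (permKV s)).
  have <- : (fun i => U (s i)) = W by apply: functional_extensionality_dep.
  exists (lst_tuple (fun i => cls (U i))); first by rewrite permt_lst.
  apply/falg_op_lst; exists U; split=> //; congr [:: _].
  by apply/clsP/eqv_sym/lcomp_perm.
move=> [t -> /falg_op_lst[W [et ->]]]; exists (fun i => W (s i)); split.
  by have -> : t = lst_tuple (fun i => cls (W i)); [exact: val_inj | rewrite permt_lst].
by congr [:: _]; apply/clsP/lcomp_perm.
Qed.

Lemma falg_op_comp n (k : 'I_n -> nat) (b : 'I_n -> C) c (a : forall i, 'I_(k i) -> C)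
    (g : O (lst b) c) (f : forall i, O (lst (a i)) (b i)) X Y :
  sval (falg_op (ocomp g f)) X Y <->
  exists Z, sval (mhcat (T := M) (fun i => falg_op (f i))) X Z /\ sval (falg_op g) Z Y.
Proof.
rewrite -(sval_otot (otot_cast (lst_sig a) _)) falg_op_lst; split.
  move=> [Q [-> ->]].
  have bsig : bijective (@tagnat.sig n k).
    by exists (@tagnat.rank n k); [exact: tagnat.sigK | exact: tagnat.rankK].
  (* Regroups the flat family of arguments into blocks along the pairing [tagnat.sig]. *)
  have [W hW] := @bij_section _ _
    (fun p : {i & 'I_(k i)} => lop (a (tag p) (tagged p))) (@tagnat.sig n k) Q bsig.
  pose W' i j := W (existT _ i j).
  have -> : Q = (fun q => W' (tagnat.sig1 q) (tagnat.sig2 q)).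
    apply: functional_extensionality_dep => q; rewrite -hW /W' /tagnat.sig1 /tagnat.sig2.
    by case: (tagnat.sig q).
  exists (lst (fun i => cls (lcomp (f i) (W' i)))); split.
    apply/sval_mhcat; exists (fun i => lst (fun j => cls (W' i j))).
    exists (fun i => [:: cls (lcomp (f i) (W' i))]); split=> //.
      by rewrite -(lst_sig (fun i j => cls (W' i j))).
    by move=> i; apply/falg_op_lst; exists (W' i).
  apply/falg_op_lst; exists (fun i => lcomp (f i) (W' i)); split=> //.
  by congr [:: _]; apply/clsP/lcomp_lcomp.
move=> [Z [/sval_mhcat[x [y [-> -> h]]] /falg_op_lst[U [eU ->]]]].
have [W hW] := dep_choice (fun i => proj1 (falg_op_lst _ _ _) (h i)).
exists (fun q => W (tagnat.sig1 q) (tagnat.sig2 q)); split.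
  rewrite -(lst_sig (fun i j => cls (W i j))); congr lcat; apply: funext => i.
  by have [] := hW i.
congr [:: _]; apply: etrans (esym (proj2 (clsP _ _) (lcomp_lcomp g f W))).
(* The intermediate terms [U i] and [lcomp (f i) (W i)] agree only as classes. *)
apply: cls_lcomp => i.
have ey : y = fun i => [:: cls (lcomp (f i) (W i))].
  by apply: funext => j; have [] := hW j.
by rewrite ey in eU; have /(congr1 (fun h => h i)) := lst_inj (esym eU : lst _ = lst _).
Qed.

Program Definition falg_hom : operad_hom O (forget_data M) :=
  @OperadHom O (forget_data M) id (fun a c f => falg_op f) _ _ _.
Next Obligation.
move=> c; apply: rel_mor_ext => X Y.
rewrite (@falg_op_lst 1 (fun=> c)) /=; split.
  move=> [W [-> ->]]; rewrite /= fcol_cls; split=> //; congr [:: _].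
  by apply/clsP/eqv_sym/lcomp_id.
move=> [<-]; case: X => [//|v [|//]] [ev].
have [c' [w evw]] := falg_cls v; subst v; rewrite fcol_cls in ev; subst c'.
exists (fun=> w); split=> //; congr [:: _].
by apply/clsP/eqv_sym; exact: (lcomp_id (fun=> w)).
Qed.
Next Obligation.
move=> n b c a g f; apply: rel_mor_ext => X Y; rewrite sval_ocast.
have [k [al ea]] : exists (k : 'I_n -> nat) (al : forall i, 'I_(k i) -> C),
    a = fun i => lst (al i).
  exists (fun i => size (a i)), (fun i => tnth (in_tuple (a i))).
  by apply: funext => i; rewrite lst_tnth.
subst a; rewrite falg_op_comp /=; split=> -[Z [h1 h2]]; exists Z; split=> //.
  by rewrite sval_ocast.
by rewrite sval_ocast in h2.
Qed.
Next Obligation.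
move=> n a c f s; apply: rel_mor_ext => X Y; rewrite sval_ocast.
have [b eb] : exists b, a = lst_tuple b.
  by exists (tnth a); apply: val_inj; rewrite /= lst_tnth.
subst a; exact: falg_op_lact.
Qed.

Definition var (i : nat) c : lop c := @Lop c 1 [tuple i] [tuple c] (oid O c).

Lemma lcomp_var k (l : 'I_k -> nat) (b : 'I_k -> C) c (f : O (lst b) c) :
  eqv (lcomp f (fun i => var (l i) (b i)))
    (Lop (lst_tuple l) (f : O (lst_tuple b) c)).
Proof. by apply: eqv_eq => //=; rewrite (ocompf1 axO). Qed.

End FreeAlgebra.

Lemma lcat_inj X n (x y : 'I_n -> seq X) :
  (forall i, size (x i) = size (y i)) -> lcat x = lcat y -> x = y.
Proof.
elim: n x y => [|n IH] x y h; first by move=> _; apply: funext => -[].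
move=> /= /(cat_eq (h ord0))[e0 /(IH _ _ (fun i => h _)) e].
apply: funext => i; case: (unliftP ord0 i) => [j|] -> //.
exact: (congr1 (fun z : 'I_n -> seq X => z j) e).
Qed.

(** * Evaluation at the tuple of distinct variables *)

Section GenericElement.

Variable O : operad.
Local Notation C := (ocol O).
Let axO := oaxioms O.
Variables (n : nat) (a : n.-tuple C).

Definition gen (i : 'I_n) : falg O := cls (@var O i (tnth a i)).

(** The term [f] applied to the variables numbered by [l]; its labels recover [l]. *)
Definition block (l : seq 'I_n) c (f : O (map (tnth a) l) c) : lop c :=
  Lop (map_tuple (@nat_of_ord n) (in_tuple l))
    (f : O (map_tuple (tnth a) (in_tuple l)) c).

Lemma falg_op_gen (l : seq 'I_n) c (f : O (map (tnth a) l) c) Y :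
  sval (falg_op f) (map gen l) Y <-> Y = [:: cls (block f)].
Proof.
have lst_l D (h : 'I_n -> D) : map h l = lst (fun i => h (tnth (in_tuple l) i)).
  exact: etrans (congr1 (map h) (esym (lst_tnth (in_tuple l)))) (map_lst _ _).
set e := lst_l _ (tnth a); rewrite -(sval_otot (otot_cast e f)) falg_op_lst.
pose V i := @var O (tnth (in_tuple l) i) (tnth a (tnth (in_tuple l) i)).
have eV : cls (lcomp (ocast e f) V) = cls (block f).
  apply/clsP; apply: eqv_trans (lcomp_var _ _) _; apply: eqv_eq => /=.
    by rewrite (lst_l _ (@nat_of_ord n)).
  by rewrite otot_cast.
rewrite lst_l; split=> [[W [eW ->]]|->]; last by exists V; rewrite eV.
rewrite -eV; congr [:: _]; apply: cls_lcomp => i.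
by have := congr1 (fun h => h i) (lst_inj eW).
Qed.

Variables (m : nat) (b : m.-tuple C).

Lemma falg_eval_gen (x : free_op a b) Y :
  sval (free_op_eval (falg_hom O) x) (map gen (enum 'I_n)) Y <->
  Y = lst (fun j => cls (block (tagged x j))).
Proof.
have -> : map gen (enum 'I_n) =
    permt (map_tuple gen (fibers_tuple (tag x))) (unshuffle (tag x)).
  by rewrite permt_map permt_fibers.
rewrite /free_op_eval sval_mcast.
rewrite [X in X <-> _](@rel_lact_tuple _ _ (@fcol O)) sval_mcast.
rewrite sval_mhcat; split.
  move=> [X [Z [eX -> h]]].
  (* The colours fix the length of each piece, so the generic tuple splits in only one way. *)
  have {}eX : X = fun j => map gen (fiber (tag x) j).
    apply: lcat_inj; last by rewrite -eX -map_lcat.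
    by move=> j; rewrite (rel_size (h j)).1 !size_map.
  subst X; congr lcat; apply: funext => j.
  exact/falg_op_gen.
move=> ->; exists (fun j => map gen (fiber (tag x) j)).
exists (fun j => [:: cls (block (tagged x j))]); split=> //.
  by rewrite /= -map_lcat.
by move=> j; apply/falg_op_gen.
Qed.

(** Equivalent terms have the same labels up to order, which gives equal fibers and hence equal
    [theta]. Within a fiber the labels are distinct and listed in the same order, so the permutation
    relating the two terms is the identity and the operations coincide. *)
Lemma falg_eval_inj (x y : free_op a b) :
  free_op_eval (falg_hom O) x = free_op_eval (falg_hom O) y -> x = y.
Proof.
move=> e; have := proj2 (falg_eval_gen x _) erefl; rewrite e.
move/falg_eval_gen/lst_inj => ecls.
have eb j : eqv (block (tagged x j)) (block (tagged y j)).
  by apply/clsP; exact: (congr1 (fun h => h j) ecls).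
case: x y {e ecls} eb => theta f [theta' f'] eb /=.
have et : theta = theta'.
  apply/ffunP => i; have [s el _] := eb (theta' i).
  have : perm_eq (map (@nat_of_ord n) (fiber theta' (theta' i)))
      (map_tuple (@nat_of_ord n) (in_tuple (fiber theta (theta' i)))).
    by apply/tuple_permP; exists s; exact: el.
  move/(perm_map_inj val_inj)/perm_mem/(_ i); rewrite !mem_fiber eqxx.
  by move/esym/eqP.
subst theta'; congr existT; apply: functional_extensionality_dep => j.
have [s el /optot_otot eh] := eb j.
have s1 : s = 1%g.
  apply: (permt_inj (a := map_tuple (@nat_of_ord n) (in_tuple (fiber theta j)))).
    by rewrite (map_inj_uniq val_inj) uniq_fiber.
  by apply: val_inj; apply: etrans (esym (permt_id _)); exact: esym el.
by apply/otot_inj/esym/(etrans eh); rewrite s1 (oact1 axO) otot_cast.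
Qed.

End GenericElement.

(** * The free prop *)

Section FreeProp.

Variable O : operad.
Local Notation C := (ocol O).

Definition free_mor (a b : seq C) : Type := free_op (in_tuple a) (in_tuple b).

Definition fev (P : prop) (eta : operad_hom O (forget_data P)) a b (x : free_mor a b) :
  P (map eta a) (map eta b) := free_op_eval eta x.

(** Pairs are indexed by tuples and morphisms of a prop by lists. The retyping is kept abstract:
    only its bijectivity and its effect on evaluation are needed. *)
Lemma free_op_in_tuple n m (a : n.-tuple C) (b : m.-tuple C) :
  exists2 u : free_op a b -> free_mor a b, bijective u &
  forall x (P : prop) (eta : operad_hom O (forget_data P)),
    mtot (fev eta (u x)) = mtot (free_op_eval eta x).
Proof.
case: a b => a ha [b hb]; have ea := eqP ha; have eb := eqP hb.
subst n m.
have -> : Tuple ha = in_tuple a by exact: val_inj.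
have -> : Tuple hb = in_tuple b by exact: val_inj.
by exists id => //; exists id.
Qed.

Lemma free_mor_of n m (a : n.-tuple C) (b : m.-tuple C)
    (y : forall P, operad_hom O (forget_data P) -> tot P) :
  (exists z : free_op a b, forall P eta, mtot (free_op_eval (P := P) eta z) = y P eta) ->
  exists z : free_mor a b, forall P eta, mtot (fev (P := P) eta z) = y P eta.
Proof.
have [u _ hu] := free_op_in_tuple a b.
by case=> z hz; exists (u z) => P eta; rewrite hu.
Qed.

Lemma free_op_of_mor n m (a : n.-tuple C) (b : m.-tuple C) (x : free_mor a b) :
  exists z : free_op a b, forall (P : prop) (eta : operad_hom O (forget_data P)),
    mtot (free_op_eval eta z) = mtot (fev eta x).
Proof.
have [u [v uv vu] hu] := free_op_in_tuple a b.
by exists (v x) => P eta; rewrite -hu vu.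
Qed.

Lemma free_mor_unit a c (f : O a c) : exists z : free_mor a [:: c],
  forall (P : prop) (eta : operad_hom O (forget_data P)),
    mtot (fev eta z) = mtot (ohop eta f : P _ [:: eta c]).
Proof. exact: free_mor_of (free_op_unit (a := in_tuple a) f). Qed.

Lemma free_mor_id0 : exists z : free_mor [::] [::],
  forall (P : prop) (eta : operad_hom O (forget_data P)),
    mtot (fev eta z) = mtot (mid0 P).
Proof. exact: free_mor_of (free_op_id0 O). Qed.

Lemma free_mor_vcomp a b c (f : free_mor b c) (g : free_mor a b) :
  exists z : free_mor a c, forall (P : prop) (eta : operad_hom O (forget_data P)),
    mtot (fev eta z) = mtot (mvcomp (fev eta f) (fev eta g)).
Proof. exact: free_mor_of (free_op_vcomp f g). Qed.

Lemma free_mor_hcomp a b a' b' (f : free_mor a b) (g : free_mor a' b') :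
  exists z : free_mor (a ++ a') (b ++ b'),
  forall (P : prop) (eta : operad_hom O (forget_data P)),
    mtot (fev eta z) = mtot (mhcomp (fev eta f) (fev eta g)).
Proof. exact: free_mor_of (free_op_hcomp f g). Qed.

Lemma free_mor_lact n (a : n.-tuple C) b (f : free_mor a b) (s : 'S_n) :
  exists z : free_mor (permt a s) b,
  forall (P : prop) (eta : operad_hom O (forget_data P)),
    mtot (fev eta z) = mtot (mlact (a := map_tuple eta a) (fev eta f) s).
Proof.
have [x hx] := @free_op_of_mor _ _ a (in_tuple b) f.
have [z hz] := free_mor_of (free_op_lact x s).
by exists z => P eta; rewrite hz; apply: mtot_lact; apply: hx.
Qed.

Lemma free_mor_ract m a (b : m.-tuple C) (f : free_mor a b) (s : 'S_m) :
  exists z : free_mor a (permt b s^-1%g),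
  forall (P : prop) (eta : operad_hom O (forget_data P)),
    mtot (fev eta z) = mtot (mract (b := map_tuple eta b) (fev eta f) s).
Proof.
have [x hx] := @free_op_of_mor _ _ (in_tuple a) b f.
have [z hz] := free_mor_of (free_op_ract x s).
by exists z => P eta; rewrite hz; apply: mtot_ract; apply: hx.
Qed.

Definition free_unit a c (f : O a c) : free_mor a [:: c] := projT1 (cid (free_mor_unit f)).

Definition free_data : prop_data C :=
  @PropData C free_mor
    (fun c => free_unit (oid O c))
    (projT1 (cid free_mor_id0))
    (fun a b c f g => projT1 (cid (free_mor_vcomp f g)))
    (fun a b a' b' f g => projT1 (cid (free_mor_hcomp f g)))
    (fun n a b f s => projT1 (cid (free_mor_lact f s)))
    (fun m a b f s => projT1 (cid (free_mor_ract f s))).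

Section Eval.

Variables (P : prop) (eta : operad_hom O (forget_data P)).
Local Notation ev := (fev eta).

Lemma fev_unit a c (f : O a c) : mtot (ev (free_unit f)) = mtot (ohop eta f : P _ [:: eta c]).
Proof. by rewrite /free_unit; case: cid. Qed.

Lemma fev_id c : mtot (ev (mid free_data c)) = mtot (mid P (eta c)).
Proof. by apply: etrans (fev_unit _) _; rewrite ohop_id. Qed.

Lemma fev_id0 : mtot (ev (mid0 free_data)) = mtot (mid0 P).
Proof. by rewrite /=; case: cid. Qed.

Lemma fev_vcomp a b c (f : free_data b c) (g : free_data a b) :
  mtot (ev (mvcomp f g)) = mtot (mvcomp (ev f) (ev g)).
Proof. by rewrite /=; case: cid. Qed.

Lemma fev_hcomp a b a' b' (f : free_data a b) (g : free_data a' b') :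
  mtot (ev (mhcomp f g)) = mtot (mhcomp (ev f) (ev g)).
Proof. by rewrite /=; case: cid. Qed.

Lemma fev_lact n (a : n.-tuple C) b (f : free_data a b) (s : 'S_n) :
  mtot (ev (mlact f s)) = mtot (mlact (a := map_tuple eta a) (ev f) s).
Proof. by rewrite /=; case: cid. Qed.

Lemma fev_ract m a (b : m.-tuple C) (f : free_data a b) (s : 'S_m) :
  mtot (ev (mract f s)) = mtot (mract (b := map_tuple eta b) (ev f) s).
Proof. by rewrite /=; case: cid. Qed.

Lemma fev_mcast a a' b b' (ea : a = a') (eb : b = b') (f : free_data a b) :
  mtot (ev (mcast ea eb f)) = mtot (ev f).
Proof. by case: _ / ea; case: _ / eb. Qed.

Lemma fev_midl a : mtot (ev (midl free_data a)) = mtot (midl P (map eta a)).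
Proof.
elim: a => [|c a IH]; first exact: fev_id0.
apply: etrans (fev_hcomp (mid free_data c) (midl free_data a)) _.
exact: (mtot_hcomp (fev_id c) IH).
Qed.

End Eval.

Let M := rel_prop (@fcol O).
Let eta : operad_hom O (forget_data M) := falg_hom O.
Let ax := pon_axioms (pon M).
Local Notation ev := (fev eta).

Lemma free_mor_eq a b (f g : free_data a b) : mtot (ev f) = mtot (ev g) -> f = g.
Proof. by move=> e; apply/falg_eval_inj/mtot_inj. Qed.

Lemma free_axioms : prop_axioms free_data.
Proof.
split.
- move=> a b c d f g h; apply: free_mor_eq; rewrite !fev_vcomp.
  rewrite (mtot_vcomp erefl (fev_vcomp _ _ _)) (mvcompA ax).
  by apply/esym/mtot_vcomp => //; apply: fev_vcomp.
- move=> a b a' b' a'' b'' f g h; apply: free_mor_eq; rewrite fev_mcast !fev_hcomp.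
  apply: etrans (mtot_hcomp (fev_hcomp eta f g) erefl) _.
  rewrite (mhcompA ax) mtot_cast.
  exact: esym (mtot_hcomp erefl (fev_hcomp eta g h)).
- move=> a b f; apply: free_mor_eq; rewrite fev_hcomp.
  apply: etrans (mtot_hcomp (fev_id0 eta) erefl) _.
  by rewrite (mhcomp0f ax).
- move=> a b f; apply: free_mor_eq; rewrite fev_mcast fev_hcomp.
  apply: etrans (mtot_hcomp erefl (fev_id0 eta)) _.
  by rewrite (mhcompf0 ax) mtot_cast.
- move=> a b f; apply: free_mor_eq; rewrite fev_vcomp.
  apply: etrans (mtot_vcomp (fev_midl eta b) erefl) _.
  by rewrite (mvcomp1f ax).
- move=> a b f; apply: free_mor_eq; rewrite fev_vcomp.
  apply: etrans (mtot_vcomp erefl (fev_midl eta a)) _.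
  by rewrite (mvcompf1 ax).
- move=> a b c a' b' c' f g f' g'; apply: free_mor_eq; rewrite fev_vcomp fev_hcomp.
  apply: etrans (mtot_hcomp (fev_vcomp eta f g) (fev_vcomp eta f' g')) _.
  rewrite (mvcomp_hcomp ax).
  exact: esym (mtot_vcomp (fev_hcomp eta f f') (fev_hcomp eta g g')).
- move=> n a b c s f g; apply: free_mor_eq; rewrite !fev_vcomp.
  (* [permt] and [map] commute only up to a proved equality, so [ev g] is retyped to fit the axiom
     of [M]. *)
  pose g' : M (map eta a) (permt (map_tuple eta b) s) :=
    mcast erefl (esym (permt_map eta b s)) (ev g).
  have eg : mtot g' = mtot (ev g) by rewrite mtot_cast.
  apply: etrans _ (esym (mtot_vcomp (fev_lact eta f s) (esym eg))).
  rewrite -(mvcomp_act ax); apply: mtot_vcomp => //.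
  rewrite fev_mcast [RHS]mtot_cast; apply: etrans (fev_ract eta (b := permt b s) g s) _.
  exact: (mtot_ract (b := map_tuple eta (permt b s))
    (b' := permt (map_tuple eta b) s) _ (esym eg)).
- move=> n a b c f g s; apply: free_mor_eq; rewrite fev_lact fev_vcomp.
  apply: etrans (mtot_lact (a := map_tuple eta a)
    (a' := map_tuple eta a) s (fev_vcomp eta f g)) _.
  rewrite (mlact_vcomp ax); exact: esym (mtot_vcomp erefl (fev_lact eta g s)).
- move=> m a b c f g s; apply: free_mor_eq; rewrite fev_ract fev_vcomp.
  apply: etrans (mtot_ract (b := map_tuple eta c)
    (b' := map_tuple eta c) s (fev_vcomp eta f g)) _.
  rewrite (mract_vcomp ax); exact: esym (mtot_vcomp (fev_ract eta f s) erefl).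
- move=> n p a a' b b' f g s t; apply: free_mor_eq; rewrite fev_mcast fev_hcomp.
  apply: etrans (mtot_hcomp (fev_lact eta f s) (fev_lact eta g t)) _.
  rewrite (mlact_hcomp ax) [LHS]mtot_cast (fev_lact _ (a := cat_tuple a a')).
  apply: (mtot_lact (a := cat_tuple (map_tuple eta a) (map_tuple eta a'))
    (a' := map_tuple eta (cat_tuple a a'))).
  exact: esym (fev_hcomp eta f g).
- move=> m q a a' b b' f g s t; apply: free_mor_eq; rewrite fev_mcast fev_hcomp.
  apply: etrans (mtot_hcomp (fev_ract eta f s) (fev_ract eta g t)) _.
  rewrite (mract_hcomp ax) [LHS]mtot_cast (fev_ract _ (b := cat_tuple b b')).
  apply: (mtot_ract (b := cat_tuple (map_tuple eta b) (map_tuple eta b'))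
    (b' := map_tuple eta (cat_tuple b b'))).
  exact: esym (fev_hcomp eta f g).
- move=> n m p q a b a' b' f g; apply: free_mor_eq; rewrite fev_mcast fev_hcomp.
  rewrite -(mhcompC ax (a := map_tuple eta a) (b := map_tuple eta b)
    (a' := map_tuple eta a') (b' := map_tuple eta b')) [RHS]mtot_cast.
  rewrite (fev_lact _ (a := cat_tuple a a')).
  apply: (mtot_lact (a := map_tuple eta (cat_tuple a a'))
    (a' := cat_tuple (map_tuple eta a) (map_tuple eta a'))).
  rewrite (fev_ract _ (b := cat_tuple b b')).
  apply: (mtot_ract (b := map_tuple eta (cat_tuple b b'))
    (b' := cat_tuple (map_tuple eta b) (map_tuple eta b'))).
  exact: fev_hcomp.
- move=> n m a b f s t; apply: free_mor_eq; rewrite fev_lact fev_ract.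
  apply: etrans (mtot_lact (a := map_tuple eta a)
    (a' := map_tuple eta a) s (fev_ract eta f t)) _.
  rewrite (mlact_ract ax (a := map_tuple eta a) (b := map_tuple eta b)).
  exact: esym (mtot_ract (b := map_tuple eta b)
    (b' := map_tuple eta b) t (fev_lact eta f s)).
- move=> n a b f s t; apply: free_mor_eq; rewrite fev_mcast !fev_lact.
  rewrite -(mtot_cast (esym (permt_mul (map_tuple eta a) s t)) erefl).
  rewrite -(mlactM ax).
  exact: (mtot_lact (a := map_tuple eta (permt a t))
    (a' := permt (map_tuple eta a) t) s (fev_lact eta f t)).
- move=> m a b f s t; apply: free_mor_eq; rewrite fev_mcast !fev_ract.
  rewrite -(mtot_cast erefl (permt_mulV (map_tuple eta b) s t)).
  rewrite -(mractM ax).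
  exact: (mtot_ract (b := map_tuple eta (permt b t^-1%g))
    (b' := permt (map_tuple eta b) t^-1%g) s (fev_ract eta f t)).
- move=> n a b f; apply: free_mor_eq; rewrite fev_mcast fev_lact.
  by rewrite (mlact1 ax) mtot_cast.
- move=> m a b f; apply: free_mor_eq; rewrite fev_mcast fev_ract.
  by rewrite (mract1 ax) mtot_cast.
Qed.

Definition free_prop : prop_on C := PropOn free_axioms.

Section Extension.

Variables (P : prop) (zeta : operad_hom O (forget_data P)).

Program Definition free_ext : prop_hom (MkProp free_prop) P :=
  @PropHom (MkProp free_prop) P zeta (fun a b x => fev zeta x) _ _ _ _ _ _.
Next Obligation. by move=> c; apply: mtot_inj; apply: fev_id. Qed.
Next Obligation. by apply: mtot_inj; apply: fev_id0. Qed.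
Next Obligation. by move=> a b c f g; apply: mtot_inj; apply: fev_vcomp. Qed.
Next Obligation.
by move=> a b a' b' f g; apply: mtot_inj; rewrite mtot_cast; apply: fev_hcomp.
Qed.
Next Obligation.
by move=> n a b f s; apply: mtot_inj; rewrite mtot_cast; apply: fev_lact.
Qed.
Next Obligation.
by move=> m a b f s; apply: mtot_inj; rewrite mtot_cast; apply: fev_ract.
Qed.

End Extension.

End FreeProp.

(** * The adjunction *)

(** Evaluation is built from horizontal composites and an input permutation, which a prop
    homomorphism preserves. *)
Lemma hmor_free_op_eval (O : operad) (R T : prop) (h : prop_hom R T)
    (eta : operad_hom O (forget_data R)) n m (a : n.-tuple (ocol O))
    (b : m.-tuple (ocol O)) (x : free_op a b) :
  mtot (hmor h (free_op_eval eta x)) =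
  mtot (free_op_eval (operad_comp (forget_hom h) eta) x).
Proof.
rewrite (mtot_hmor _ (mtot_cast _ _ _)) hmor_lact mtot_cast [RHS]mtot_cast.
apply: mtot_lact; rewrite (mtot_hmor _ (mtot_cast _ _ _)) hmor_mhcat [RHS]mtot_cast.
by apply: mtot_mhcat => j; rewrite [RHS]mtot_ocast.
Qed.

(** * The unit and its universal property *)

Section Unit.

Variable O : operad.
Local Notation C := (ocol O).
Local Notation F := (MkProp (free_prop O)).

Lemma fev_mhcat (P : prop) (eta : operad_hom O (forget_data P)) n
    (a b : 'I_n -> seq C) (f : forall i, free_data O (a i) (b i)) :
  mtot (fev eta (mhcat f)) = mtot (mhcat (fun i => fev eta (f i))).
Proof. exact: (hmor_mhcat (free_ext eta)). Qed.

Lemma fev_ocast (P : prop) (eta : operad_hom O (forget_data P)) a a' c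
    (e : a = a') (f : forget_data F a c) :
  mtot (fev eta (ocast e f : F a' [:: c])) = mtot (fev eta (f : F a [:: c])).
Proof. by case: _ / e. Qed.

Program Definition free_incl : operad_hom O (forget_data F) :=
  @OperadHom O (forget_data F) id
    (fun a c f => mcast (esym (map_id a)) erefl (free_unit f)) _ _ _.
Next Obligation. by move=> c; apply: mtot_inj; rewrite mtot_cast. Qed.
Next Obligation.
move=> n b c a g f; apply: free_mor_eq.
apply: etrans (fev_mcast _ _ _ _) _.
rewrite fev_unit ohop_comp mtot_ocast.
rewrite fev_ocast; apply/esym; apply: etrans (fev_vcomp _ _ _) _.
apply: mtot_vcomp.
  rewrite [RHS]mtot_ocast; apply: etrans (fev_ocast _ _ _) _.
  by apply: etrans (fev_mcast _ _ _ _) _; exact: fev_unit.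
apply: etrans (fev_mhcat _ _) _; apply: mtot_mhcat => i.
by apply: etrans (fev_mcast _ _ _ _) _; exact: fev_unit.
Qed.
Next Obligation.
move=> n a c f s; apply: free_mor_eq.
apply: etrans (fev_mcast _ _ _ _) _.
rewrite fev_unit ohop_act mtot_ocast.
rewrite fev_ocast; apply/esym; apply: etrans (fev_lact _ _ _) _.
by apply: mtot_lact; apply: etrans (fev_mcast _ _ _ _) _; exact: fev_unit.
Qed.

Lemma free_ext_incl (P : prop) (zeta : operad_hom O (forget_data P)) :
  operad_comp (forget_hom (free_ext zeta)) free_incl = zeta.
Proof.
case: zeta => h mh h1 h2 h3; apply: operad_hom_ext => a c f.
rewrite otot_cast; apply: otot_mtot.
have e := fev_mcast (OperadHom h1 h2 h3) (esym (map_id a)) erefl (free_unit f).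
exact: etrans e (fev_unit _ f).
Qed.

(** The extension of [falg_hom] sends the left side to the evaluation of [x] along [falg_hom], by
    compatibility of homomorphisms with evaluation. Injectivity of that evaluation gives the
    claim. *)
Lemma fev_incl a b (x : free_mor a b) : mtot (fev free_incl x) = mtot x.
Proof.
pose y : free_data O a b := mcast (map_id a) (map_id b) (fev free_incl x).
have e : mtot (fev (falg_hom O) x) = mtot (fev (falg_hom O) y).
  rewrite [RHS]fev_mcast.
  have := hmor_free_op_eval (free_ext (falg_hom O)) free_incl x.
  by rewrite free_ext_incl => e; apply: etrans (esym e) _.
by rewrite [in RHS](free_mor_eq e) [RHS]mtot_cast.
Qed.

(** Since [x] is its own evaluation along [free_incl], and [v] commutes with evaluation, [v] is
    determined by its restriction along [free_incl]. *)
Lemma free_ext_unique (P : prop) (v : prop_hom F P) :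
  free_ext (operad_comp (forget_hom v) free_incl) = v.
Proof.
apply: prop_hom_ext => // a b x.
apply: etrans (esym (hmor_free_op_eval v free_incl x)) _.
exact/mtot_hmor/fev_incl.
Qed.

Lemma free_incl_bij n m (a : n.-tuple C) (b : m.-tuple C) :
  bijective (@free_op_eval O F free_incl n m a b).
Proof.
have [u [v uv vu] hu] := free_op_in_tuple a b.
have e x : mtot (free_op_eval free_incl x) = mtot (u x).
  by rewrite -hu fev_incl.
exists (fun y => v (mcast (map_id a) (map_id b) y)) => [x|y].
  rewrite -[RHS]uv; congr v; apply: mtot_inj.
  by rewrite mtot_cast e.
by apply: mtot_inj; rewrite e vu mtot_cast.
Qed.

End Unit.

Definition free_obj (O : Operad_cat) : Prop_cat := MkProp (free_prop O).

Definition free_adj (O : Operad_cat) (P : Prop_cat) (v : hom (free_obj O) P) :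
  hom O (forget P) := Defs.comp (fmap forget v) (free_incl O : hom O (forget (free_obj O))).

Lemma free_adjK O P : cancel (@free_adj O P) (@free_ext O P).
Proof. exact: free_ext_unique. Qed.

Lemma free_extK O P : cancel (@free_ext O P) (@free_adj O P).
Proof. exact: free_ext_incl. Qed.

(** The functor induced by universal arrows; its laws are checked after applying the injective map
    [free_adj]. *)
Definition free_fmap (O O' : Operad_cat) (u : hom O O') : hom (free_obj O) (free_obj O') :=
  @free_ext O (free_obj O') (Defs.comp (free_incl O' : hom O' (forget (free_obj O'))) u).

Lemma free_adj_id O : free_adj (Defs.idm (free_obj O)) = free_incl O.
Proof. by rewrite /free_adj /fmap fmap_on_id comp1m. Qed.

Lemma free_adj_comp O P P' (w : hom P P') (v : hom (free_obj O) P) :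
  free_adj (Defs.comp w v) = Defs.comp (fmap forget w) (free_adj v).
Proof. by rewrite /free_adj /fmap fmap_on_comp Defs.compA. Qed.

Lemma free_adj_fmap O O' P (u : hom O O') (v : hom (free_obj O') P) :
  free_adj (Defs.comp v (free_fmap u)) = Defs.comp (free_adj v) u.
Proof. by rewrite free_adj_comp [free_adj (free_fmap u)]free_extK Defs.compA. Qed.

Program Definition free_functor : functor_on free_obj :=
  @FunctorOn Operad_cat Prop_cat free_obj free_fmap _ _.
Next Obligation.
move=> O; apply: (can_inj (@free_adjK O _)).
by rewrite free_adj_id [LHS]free_extK compm1.
Qed.
Next Obligation.
move=> O O' O'' g f; apply: (can_inj (@free_adjK O _)).
by rewrite free_adj_fmap ![free_adj (free_fmap _)]free_extK Defs.compA.
Qed.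

Definition free_adjunction : adjunction (Functor free_functor) forget :=
  @Adjunction _ _ (Functor free_functor) forget free_adj
    (fun O P => Bijective (@free_adjK O P) (@free_extK O P))
    (fun O O' P u v => free_adj_fmap u v) (fun O P P' w v => free_adj_comp w v).

Theorem proposition11 :
  exists (F0 : forall O : operad, prop_on (ocol O))
         (F1 : functor_on (C := Operad_cat) (D := Prop_cat)
                 (fun O : operad => MkProp (F0 O)))
         (A : adjunction (Functor F1) forget),
  forall O : operad,
    (forall c : ocol O, (adj_unit A O : operad_hom O _) c = c) /\
    forall (n m : nat) (a : n.-tuple (ocol O)) (b : m.-tuple (ocol O)),
      bijective
        (@free_op_eval O (MkProp (F0 O)) (adj_unit A O) n m a b).
Proof.
exists free_prop, free_functor, free_adjunction => O; split=> // n m a b.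
have -> : adj_unit free_adjunction O = free_incl O by exact: free_adj_id.
exact: free_incl_bij.
Qed.
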